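(* Let the data of the backward linear-quadratic problem, Problem (BLQ), be as in the context, and assume: (i) $M$ is positive definite; (ii) for every $(\omega,k)\in\Omega\times\mathbb T_\infty$, $Q_k$ and $L_k$ are nonnegative definite; (iii) there is a constant $\delta>0$ such that $R_k-\delta I_m\ge0$ for every $(\omega,k)\in\Omega\times\mathbb T_\infty$; (iv) $\rho<-\ln\big(6(\|A(\cdot)\|_\infty+\|B(\cdot)\|_\infty)^2\big)$. Then the Hamiltonian system $$\begin{cases}\bar x_{k+1}=e^{\rho}A_k^\top\bar x_k-e^{\rho}Q_k\bar y'_{k+1}+e^{\rho}\big(B_k^\top\bar x_k-L_k\bar z'_{k+1}\big)w_k,\\ \bar y_k=A_k\bar y'_{k+1}+B_k\bar z'_{k+1}+C_k\bar v_k+\alpha_k,\qquad k\in\mathbb T_\infty,\\ \bar x_0=-M\bar y_0,\\ 0=C_k^\top\bar x_k-R_k\bar v_k,\end{cases}$$ where $\bar y'_{k+1}=\mathbb E[\bar y_{k+1}|\mathcal F_{k-1}]$ and $\bar z'_{k+1}=\mathbb E[\bar y_{k+1}w_k|\mathcal F_{k-1}]$, admits a unique solution $(\bar x(\cdot),\bar y(\cdot))\in N^{2,\rho}(\mathbb T_\infty;\mathbb R^{2n})$. Moreover, $$\bar v_k=R_k^{-1}C_k^\top\bar x_k,\quad k\in\mathbb T_\infty,$$ is the unique optimal control of Problem (BLQ).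
   Context: $\mathbb T_\infty=\{0,1,2,\dots\}$. $(\Omega,\mathcal F,\mathbb F,\mathbb P)$ is a complete filtered probability space carrying a real-valued martingale difference sequence $\{w_k\}_{k\in\mathbb T_\infty}$; $\mathcal F_k$ is the $\sigma$-algebra generated by $x_0,w_0,\dots,w_k$ for $k\ge0$, $\mathcal F_{-1}=\{\emptyset,\Omega\}$ (so $x_0$ is deterministic), and $\mathbb E[w_{k+1}|\mathcal F_k]=0$, $\mathbb E[w_{k+1}^2|\mathcal F_k]=1$ for all $k\ge-1$. For a Euclidean space $\mathbb H$, $L^{2,\rho}_{\mathbb F}(\mathbb T_\infty;\mathbb H)$ is the set of $\mathbb H$-valued processes $g=(g_0,g_1,\dots)$ with $g_k$ $\mathcal F_{k-1}$-measurable for every $k$ and $\mathbb E\sum_{k=0}^\infty e^{-\rho k}|g_k|^2<\infty$; $L^\infty_{\mathbb F}(\mathbb T_\infty;\mathbb H)$ is the set of essentially bounded (uniformly in $k,\omega$) processes $h$ with $h_k$ $\mathcal F_{k-1}$-measurable, with norm $\|h\|_\infty=\sup_k\operatorname{ess\,sup}_\omega|h_k|$; matrices carry the norm $|A|=\sqrt{\operatorname{tr}(AA^\top)}$. $N^{2,\rho}(\mathbb T_\infty;\mathbb R^{2n})=L^{2,\rho}_{\mathbb F}(\mathbb T_\infty;\mathbb R^n)^2$. $\mathbb S^n$ is the set of symmetric $n\times n$ real matrices. $\mathbb U=L^{2,\rho}_{\mathbb F}(\mathbb T_\infty;\mathbb R^m)$ is the set of admissible controls. Data: $A(\cdot),B(\cdot)\in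 L^\infty_{\mathbb F}(\mathbb T_\infty;\mathbb R^{n\times n})$, $C(\cdot)\in L^\infty_{\mathbb F}(\mathbb T_\infty;\mathbb R^{n\times m})$, $\alpha(\cdot)\in L^{2,\rho}_{\mathbb F}(\mathbb T_\infty;\mathbb R^n)$, $M\in\mathbb S^n$, $Q(\cdot),L(\cdot)\in L^\infty_{\mathbb F}(\mathbb T_\infty;\mathbb S^n)$, $R(\cdot)\in L^\infty_{\mathbb F}(\mathbb T_\infty;\mathbb S^m)$. State equation: for $v(\cdot)\in\mathbb U$, $$y_k=A_ky'_{k+1}+B_kz'_{k+1}+C_kv_k+\alpha_k,\ k\in\mathbb T_\infty,\qquad y'_{k+1}=\mathbb E[y_{k+1}|\mathcal F_{k-1}],\ z'_{k+1}=\mathbb E[y_{k+1}w_k|\mathcal F_{k-1}],$$ which under the condition on $\rho$ has a unique solution $y(\cdot)\in L^{2,\rho}_{\mathbb F}(\mathbb T_\infty;\mathbb R^n)$. Cost: $J(v(\cdot))=\frac12\mathbb E\big\{\langle My_0,y_0\rangle+\sum_{k=0}^\infty e^{-\rho k}[\langle Q_ky'_{k+1},y'_{k+1}\rangle+\langle L_kz'_{k+1},z'_{k+1}\rangle+\langle R_kv_k,v_k\rangle]\big\}$. Problem (BLQ): find $\bar v(\cdot)\in\mathbb U$ with $J(\bar v(\cdot))=\inf_{v(\cdot)\in\mathbb U}J(v(\cdot))$; such $\bar v(\cdot)$ is called an optimal control. *)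

(* Defs.v *)
From HB Require Import structures.
From mathcomp Require Import all_boot all_order all_algebra.
From mathcomp Require Import all_classical all_reals all_analysis.
From mathcomp Require Import ess_sup_inf sesquilinear.
Set Implicit Arguments.
Unset Strict Implicit.
Unset Printing Implicit Defensive.
Import Order.TTheory GRing.Theory Num.Theory.
Import numFieldNormedType.Exports.
Local Open Scope classical_set_scope.
Local Open Scope ring_scope.

(** ** Linear algebra *)

Definition inner (R : realType) (n : nat) (u v : 'cV[R]_n) : R :=
  (u^T *m v) ord0 ord0.

Definition nonneg_def (R : realType) (n : nat) (S : 'M[R]_n) : Prop :=
  forall u : 'cV[R]_n, 0 <= inner (S *m u) u.

Definition pos_def (R : realType) (n : nat) (S : 'M[R]_n) : Prop :=
  forall u : 'cV[R]_n, u != 0 -> 0 < inner (S *m u) u.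

Definition frob_norm (R : realType) (p q : nat) (S : 'M[R]_(p, q)) : R :=
  Num.sqrt (\tr (S *m S^T)).

(** ** Conditional expectation with respect to a sub-sigma-algebra [G] *)

Definition measurable_wrt d (T : measurableType d) (R : realType)
    (G : set (set T)) (f : T -> R) : Prop :=
  measurable_fun [set: g_sigma_algebraType G] (f : g_sigma_algebraType G -> R).

(* [Y] is a version of E[X | G]; [X] is required to be integrable. *)
Definition is_condexp d (T : measurableType d) (R : realType)
    (P : probability T R) (G : set (set T)) (X Y : T -> R) : Prop :=
  [/\ P.-integrable setT (EFin \o X),
      P.-integrable setT (EFin \o Y),
      measurable_wrt G Y
    & forall A, G A ->
        (\int[P]_(t in A) (Y t)%:E = \int[P]_(t in A) (X t)%:E)%E].

(* A chosen version of E[X | G]; it is 0 when there is none, in particular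
   when [X] is not integrable. *)
Definition condexp d (T : measurableType d) (R : realType)
    (P : probability T R) (G : set (set T)) (X : T -> R) : T -> R :=
  xget (fun=> 0) [set Y | is_condexp P G X Y].

Definition condexp_vec d (T : measurableType d) (R : realType)
    (P : probability T R) (G : set (set T)) (n : nat)
    (X : T -> 'cV[R]_n) : T -> 'cV[R]_n :=
  fun t => \col_i condexp P G (fun s => X s i ord0) t.

(** ** The noise and its filtration *)

(* [past w k] is F_(k-1), the sigma-algebra generated by w_0, ..., w_(k-1);
   it is trivial for k = 0.  The initial state x_0 is deterministic, so it
   contributes nothing to the generated sigma-algebras. *)
Definition past d (T : measurableType d) (R : realType) (w : nat -> T -> R)
    (k : nat) : set (set T) :=
  <<s \bigcup_(i in `I_k) preimage_set_system setT (w i) measurable >>.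

Definition mart_diff_noise d (T : measurableType d) (R : realType)
    (P : probability T R) (w : nat -> T -> R) : Prop :=
  forall k,
    [/\ measurable_fun setT (w k),
        is_condexp P (past w k) (w k) (fun=> 0)
      & is_condexp P (past w k) (fun t => w k t ^+ 2) (fun=> 1)].

(** ** Spaces of processes *)

Definition process d (T : measurableType d) (R : realType) (p q : nat) :=
  nat -> T -> 'M[R]_(p, q).

(* [g k] is F_(k-1)-measurable for every [k]. *)
Definition predictable d (T : measurableType d) (R : realType)
    (w : nat -> T -> R) (p q : nat) (g : process T R p q) : Prop :=
  forall k i j, measurable_wrt (past w k) (fun t => g k t i j).

(* The elements of these spaces are processes up to [ae_same]. *)
Definition ae_same d (T : measurableType d) (R : realType)
    (P : probability T R) (p q : nat) (g h : process T R p q) : Prop :=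
  forall k, g k = h k %[ae P].

Definition L2rho d (T : measurableType d) (R : realType)
    (P : probability T R) (w : nat -> T -> R) (rho : R) (p q : nat)
    (g : process T R p q) : Prop :=
  predictable w g /\
  (\int[P]_t (\sum_(0 <= k <oo)
     (expR (- rho * k%:R) * frob_norm (g k t) ^+ 2)%:E) < +oo)%E.

Definition N2rho d (T : measurableType d) (R : realType)
    (P : probability T R) (w : nat -> T -> R) (rho : R) (n : nat)
    (x y : process T R n 1) : Prop :=
  L2rho P w rho x /\ L2rho P w rho y.

Definition sup_norm d (T : measurableType d) (R : realType)
    (P : probability T R) (p q : nat) (h : process T R p q) : \bar R :=
  ereal_sup (range (fun k => ess_sup P (fun t => (frob_norm (h k t))%:E))).

Definition Linfty d (T : measurableType d) (R : realType)
    (P : probability T R) (w : nat -> T -> R) (p q : nat)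
    (h : process T R p q) : Prop :=
  predictable w h /\ (sup_norm P h < +oo)%E.

Definition Linfty_sym d (T : measurableType d) (R : realType)
    (P : probability T R) (w : nat -> T -> R) (n : nat)
    (h : process T R n n) : Prop :=
  Linfty P w h /\ forall k t, h k t \is symmetricmx.

(** ** The backward linear-quadratic problem *)

Record blq_data d (T : measurableType d) (R : realType) (n m : nat) := BLQData {
  matA : process T R n n;
  matB : process T R n n;
  matC : process T R n m;
  inhom : process T R n 1;
  wtM : 'M[R]_n;
  wtQ : process T R n n;
  wtL : process T R n n;
  wtR : process T R m m }.

Definition blq_admissible d (T : measurableType d) (R : realType) (n m : nat)
    (P : probability T R) (w : nat -> T -> R) (rho : R)
    (D : blq_data T R n m) : Prop :=
  [/\ Linfty P w (matA D), Linfty P w (matB D), Linfty P w (matC D)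
    & L2rho P w rho (inhom D)] /\
  [/\ wtM D \is symmetricmx, Linfty_sym P w (wtQ D), Linfty_sym P w (wtL D)
    & Linfty_sym P w (wtR D)].

Section backward_lq.
Context d (T : measurableType d) (R : realType) (n m : nat).
Context (P : probability T R) (w : nat -> T -> R) (rho : R).
Context (D : blq_data T R n m).

(* [yprime y k] is y'_(k+1) and [zprime y k] is z'_(k+1). *)
Definition yprime (y : process T R n 1) : process T R n 1 :=
  fun k => condexp_vec P (past w k) (y k.+1).

Definition zprime (y : process T R n 1) : process T R n 1 :=
  fun k => condexp_vec P (past w k) (fun t => w k t *: y k.+1 t).

Definition state_eq (v : process T R m 1) (y : process T R n 1) : Prop :=
  forall k, {ae P, forall t,
    y k t = matA D k t *m yprime y k t + matB D k t *m zprime y k t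
            + matC D k t *m v k t + inhom D k t}.

(* A chosen solution in L^{2,rho} of the state equation driven by [v]. *)
Definition state (v : process T R m 1) : process T R n 1 :=
  xget (fun _ _ => 0) [set y | L2rho P w rho y /\ state_eq v y].

Definition admissible_control : set (process T R m 1) :=
  [set v | L2rho P w rho v].

Definition cost (v : process T R m 1) : \bar R :=
  let y := state v in
  ((2^-1)%:E * \int[P]_t
    ((inner (wtM D *m y 0%N t) (y 0%N t))%:E +
     \sum_(0 <= k <oo) (expR (- rho * k%:R) *
       (inner (wtQ D k t *m yprime y k t) (yprime y k t)
        + inner (wtL D k t *m zprime y k t) (zprime y k t)
        + inner (wtR D k t *m v k t) (v k t)))%:E))%E.

Definition optimal_control (v : process T R m 1) : Prop :=
  admissible_control v /\ cost v = ereal_inf (cost @` admissible_control).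

Definition hamiltonian_system (x y : process T R n 1) (v : process T R m 1) :
    Prop :=
  [/\ forall k, {ae P, forall t,
        x k.+1 t =
          expR rho *: ((matA D k t)^T *m x k t)
          - expR rho *: (wtQ D k t *m yprime y k t)
          + w k t *: (expR rho *: ((matB D k t)^T *m x k t
                                   - wtL D k t *m zprime y k t))},
      state_eq v y,
      {ae P, forall t, x 0%N t = - (wtM D *m y 0%N t)}
    & forall k, {ae P, forall t,
        0 = (matC D k t)^T *m x k t - wtR D k t *m v k t}].

Definition feedback (x : process T R n 1) : process T R m 1 :=
  fun k t => invmx (wtR D k t) *m (matC D k t)^T *m x k t.

End backward_lq.

(* Main.v *)
From HB Require Import structures.
Require Import Defs.
From mathcomp Require Import all_boot all_order all_algebra.
From mathcomp Require Import all_classical all_reals all_analysis.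
From mathcomp Require Import measurable_realfun ess_sup_inf sesquilinear.
From mathcomp Require Import ring lra.

(** The Hamiltonian system is the first-order optimality condition of a strictly
    convex quadratic minimisation problem on a Hilbert space.

    Square-summable predictable processes form a Hilbert space for
    [<g, h> = sum_k e^(- rho k) E <g_k, h_k>].  If [om_k] is known at time [k]
    and has conditional second moment 1 given the past, then the shift
    [J_om : x |-> (0, e^rho om_0 x_0, e^rho om_1 x_1, ...)] satisfies
    [|J_om x|^2 <= e^rho |x|^2] ([L2rho_noise_shift]), and its adjoint is the
    conditional mean [y |-> (E[om_k y_(k+1) | F_(k-1)])_k]
    ([noise_mean_adjoint]).  The cases [om = 1] and [om = w] are [y'] and [z'].
    Hence the state equation reads [y - K y = C v + alpha] with
    [K y = A y' + B z'], and the forward equation together with its initial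
    condition reads [x - K' x = - N y], where [K'] is the adjoint of [K] and
    [N y = J_1 (Q y') + J_w (L z') + (M y_0 at time 0)] is self-adjoint and
    nonnegative and the cost is [(<N y, y> + <R v, v>) / 2].

    The bound on [rho] gives [|K' x|^2 <= e^rho (2 |A|^2 + 2 |B|^2) |x|^2
    <= |x|^2 / 3] ([discount_contraction]), so [id - K] and [id - K'] are
    invertible ([resolvent_adjoint]).  Eliminating [x] and [y] leaves one
    equation for [v], with the coercive operator
    [R + C' (id - K')^-1 N (id - K)^-1 C]; it is solved by the symmetric
    Lax-Milgram theorem ([lax_milgram], [optimality_system_exists]).  Pairing
    the difference of two solutions with itself gives uniqueness
    ([optimality_system_unique]), and expanding the cost around a solution shows
    that it is the unique minimiser ([optimality_system_minimal]).

    Everything rests on the representation of bounded functionals ([riesz]) and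
    on the completeness of the space of processes ([L2rho_complete]).  The
    representation theorem also produces the conditional expectations
    themselves: the adjoint of the shift exists, and testing it on indicators of
    past events shows that it is a conditional expectation
    ([adjoint_is_condexp]).

    Processes that agree almost surely are not identified.  Vectors are compared
    by testing against all others, written [u ≈ v], and an operator is any
    function that has an adjoint.  Such a function is linear up to [≈], which
    accommodates the arbitrary choice of versions of conditional expectations. *)

Set Implicit Arguments.
Unset Strict Implicit.
Unset Printing Implicit Defensive.
Import Order.TTheory GRing.Theory Num.Theory.
Import numFieldNormedType.Exports.
Local Open Scope classical_set_scope.
Local Open Scope ring_scope.

(** * Complete semi-inner-product spaces *)

Section SemiInnerProduct.
Context (R : realType) (V : lmodType R).
Implicit Types (a : V -> V -> R) (u v z : V).

Definition semi_inner a : Prop :=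
  [/\ forall c u v z, a (c *: u + v) z = c * a u z + a v z,
      forall u v, a u v = a v u
    & forall u, 0 <= a u u].

(** At a geometric rate, almost sure convergence follows without extracting a
    subsequence.  The free constant makes the notion invariant under passage to
    an equivalent form. *)
Definition fast_cauchy a (s : nat -> V) : Prop :=
  exists C, forall i j, (i <= j)%N -> a (s i - s j) (s i - s j) <= C * 4^-1 ^+ i.

Definition fast_limit a (s : nat -> V) v : Prop :=
  exists C, forall i, a (s i - v) (s i - v) <= C * 4^-1 ^+ i.

Definition complete_form a : Prop :=
  forall s, fast_cauchy a s -> exists v, fast_limit a s v.

Section Theory.
Context (a : V -> V -> R) (ha : semi_inner a).

Lemma siC u v : a u v = a v u. Proof. by case: ha. Qed.
Lemma si_ge0 u : 0 <= a u u. Proof. by case: ha. Qed.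
Lemma siPl c u v z : a (c *: u + v) z = c * a u z + a v z.
Proof. by case: ha. Qed.
Lemma siDl u v z : a (u + v) z = a u z + a v z.
Proof. by rewrite -[u]scale1r siPl mul1r scale1r. Qed.
Lemma si0l z : a 0 z = 0.
Proof. by have /(canRL (addrK _)) := esym (siDl 0 0 z); rewrite addr0 subrr. Qed.
Lemma siZl c u z : a (c *: u) z = c * a u z.
Proof. by rewrite -[c *: u]addr0 siPl si0l addr0. Qed.
Lemma siNl u z : a (- u) z = - a u z.
Proof. by rewrite -scaleN1r siZl mulN1r. Qed.
Lemma siBl u v z : a (u - v) z = a u z - a v z.
Proof. by rewrite siDl siNl. Qed.
Lemma siDr u v z : a z (u + v) = a z u + a z v.
Proof. by rewrite !(siC z) siDl. Qed.
Lemma si0r z : a z 0 = 0. Proof. by rewrite siC si0l. Qed.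
Lemma siZr c u z : a z (c *: u) = c * a z u.
Proof. by rewrite !(siC z) siZl. Qed.
Lemma siNr u z : a z (- u) = - a z u.
Proof. by rewrite !(siC z) siNl. Qed.
Lemma siBr u v z : a z (u - v) = a z u - a z v.
Proof. by rewrite !(siC z) siBl. Qed.

Definition siE := (siBl, siDl, siNl, siZl, siBr, siDr, siNr, siZr, si0l, si0r).

Lemma si_cauchy_schwarz u v : a u v ^+ 2 <= a u u * a v v.
Proof.
have q c : 0 <= a u u + 2 * c * a u v + c ^+ 2 * a v v.
  have := si_ge0 (u + c *: v); rewrite !siE (siC v u).
  by move=> h; apply: le_trans h _; rewrite le_eqVlt; apply/orP; left; apply/eqP; ring.
have := si_ge0 v; rewrite le_eqVlt => /orP[/eqP v0|v0].
  rewrite -v0 mulr0; have [->|uv0] := eqVneq (a u v) 0; first by rewrite expr0n.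
  have := q (- (a u u + 1) / (2 * a u v)).
  rewrite -v0 mulr0 addr0.
  have -> : 2 * (- (a u u + 1) / (2 * a u v)) * a u v = - (a u u + 1) by field.
  by move=> h; exfalso; lra.
have := q (- a u v / a v v).
have -> : a u u + 2 * (- a u v / a v v) * a u v + (- a u v / a v v) ^+ 2 * a v v
  = a u u - a u v ^+ 2 / a v v by field; rewrite gt_eqF.
by rewrite subr_ge0 ler_pdivrMr.
Qed.

Lemma si_null u : a u u = 0 -> forall z, a u z = 0.
Proof.
move=> u0 z; have := si_cauchy_schwarz u z; rewrite u0 mul0r => h.
by apply/eqP; rewrite -sqrf_eq0 eq_le h sqr_ge0.
Qed.

Lemma si_sqD_le u v : a (u + v) (u + v) <= 2 * a u u + 2 * a v v.
Proof. by have := si_ge0 (u - v); rewrite !siE (siC v u); lra. Qed.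

End Theory.
End SemiInnerProduct.

(** The first-order condition at a minimum, without differentiation. *)
Lemma quad_ge0_lin0 (R : realType) (b c : R) :
  (forall s, 0 <= 2 * s * b + s ^+ 2 * c) -> b = 0.
Proof.
move=> h; apply/eqP; apply/negPn/negP => b0.
have c1 : 0 < `|c| + 1 by rewrite ltr_wpDl.
have := h (- b / (`|c| + 1)).
have -> : 2 * (- b / (`|c| + 1)) * b + (- b / (`|c| + 1)) ^+ 2 * c
  = (b / (`|c| + 1)) ^+ 2 * (c - 2 * (`|c| + 1)) by field; rewrite gt_eqF.
rewrite pmulr_rge0; last by rewrite exprn_even_gt0 //= mulf_neq0 // invr_eq0 gt_eqF.
have := ler_norm c; have := normr_ge0 c; lra.
Qed.

Lemma pow4_small (R : realType) (C e : R) : 0 < e -> exists i : nat, C * 4^-1 ^+ i < e.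
Proof.
move=> e0.
have h : (fun i : nat => C * 4^-1 ^+ i) @ \oo --> (C * 0 : R).
  apply: cvgM; first exact: cvg_cst.
  by apply: cvg_expr; rewrite gtr0_norm ?invf_lt1 // ?invr_gt0 // ltr1n.
rewrite mulr0 in h.
move/cvgrPdist_lt : h => /(_ e e0) [N _ hN].
exists N; have := hN N (leqnn N); rewrite /= sub0r normrN.
by apply: le_lt_trans; exact: ler_norm.
Qed.

Section Riesz.
Context (R : realType) (V : lmodType R) (a : V -> V -> R).
Hypotheses (ha : semi_inner a) (ca : complete_form a).

(** The representing vector minimises [a u u - 2 * l u]: almost-minimisers form a
    Cauchy sequence by the parallelogram identity, and the claim is the
    first-order condition at their limit. *)
Theorem riesz (l : V -> R) :
  (forall c u v, l (c *: u + v) = c * l u + l v) ->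
  (exists C, forall u, l u ^+ 2 <= C * a u u) ->
  exists u, forall z, a u z = l z.
Proof.
move=> ll [C hC].
pose F u := a u u - 2 * l u.
have lB u v : l (u - v) = l u - l v by rewrite addrC -scaleN1r ll mulN1r addrC.
have Flow u : - (`|C| + 1) <= F u.
  have := hC u; have := si_ge0 ha u; rewrite /F => a0 hu.
  have hc : C * a u u <= (`|C| + 1) * a u u.
    by apply: ler_wpM2r => //; have := ler_norm C; lra.
  have c1 : 0 < `|C| + 1 by rewrite ltr_wpDl.
  have h2 : l u ^+ 2 <= (`|C| + 1) * a u u by lra.
  have : 0 <= (l u - (`|C| + 1)) ^+ 2 by exact: sqr_ge0.
  have -> : (l u - (`|C| + 1)) ^+ 2 = l u ^+ 2 - (`|C|+1) * (2 * l u - (`|C|+1)) by ring.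
  move=> h3.
  have h4 : (`|C|+1) * (2 * l u - (`|C|+1)) <= (`|C|+1) * a u u by lra.
  by rewrite ler_pM2l // in h4; lra.
pose E := [set F u | u in [set: V]].
have Einf : has_inf E.
  split; first by exists (F 0), 0.
  by exists (- (`|C|+1)) => _ [u _ <-].
pose mu := inf E.
have muP u : mu <= F u by apply: ge_inf; [case: Einf | exists u].
have hex j : exists u, F u < mu + 4^-1 * 4^-1 ^+ j.
  have e0 : (0 : R) < 4^-1 * 4^-1 ^+ j by rewrite mulr_gt0 ?exprn_gt0 ?invr_gt0.
  by have [_ [u _ <-] hu] := inf_adherent e0 Einf; exists u.
have [u_ hu_] := choice hex.
(* the value at the midpoint of two almost-minimisers is at least the infimum *)
have cau : fast_cauchy a u_.
  exists 1 => i j ij; rewrite mul1r.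
  have := muP (2^-1 *: (u_ i + u_ j)); have := hu_ i; have := hu_ j; rewrite /F.
  have -> : l (2^-1 *: (u_ i + u_ j)) = 2^-1 * (l (u_ i) + l (u_ j)).
    have := ll 2^-1 (u_ i + u_ j) 0; have := ll 1 (u_ i) (u_ j).
    have l0 : l 0 = 0 by rewrite -(subrr 0) lB subrr.
    by rewrite scale1r mul1r l0 !addr0 => -> ->.
  rewrite !(siE ha) (siC ha (u_ j)).
  have : (4^-1 : R) ^+ j <= 4^-1 ^+ i by apply: ler_wiXn2l; rewrite ?invr_ge0 ?invf_le1 ?ler1n.
  lra.
have [u [C' hu]] := ca cau.
exists u => z; apply/eqP; rewrite -subr_eq0; apply/eqP.
apply: (@quad_ge0_lin0 _ _ (a z z)) => s.
apply/ler_addgt0Pr => e e0.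
have [j hj] := pow4_small (1 + 2 / e * (s ^+ 2 * (`|C'| * a z z)))
  (divr_gt0 e0 (ltr0Sn R 1)).
have min := muP (u_ j + s *: z); have hm := hu_ j.
have lP : l (u_ j + s *: z) = l (u_ j) + s * l z by rewrite addrC ll addrC.
rewrite /F lP !(siE ha) (siC ha z) in min; rewrite /F in hm.
set x := s * a (u_ j - u) z.
have x2 : x ^+ 2 <= s ^+ 2 * (`|C'| * a z z) * 4^-1 ^+ j.
  rewrite exprMn -mulrA ler_wpM2l ?sqr_ge0 //.
  apply: le_trans (si_cauchy_schwarz ha _ _) _.
  rewrite mulrAC ler_wpM2r ?(si_ge0 ha) //; apply: le_trans (hu j) _.
  by rewrite ler_wpM2r ?ler_norm // exprn_ge0 // invr_ge0.
(* the cross term between [u_ j] and the limit is absorbed by this splitting *)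
have amgm : 2 * x <= 2 / e * x ^+ 2 + e / 2.
  rewrite -subr_ge0.
  have -> : 2 / e * x ^+ 2 + e / 2 - 2 * x = 2 / e * (x - e / 2) ^+ 2.
    by field; rewrite gt_eqF.
  by rewrite mulr_ge0 ?sqr_ge0 // divr_ge0 // ltW.
have x2' : 2 / e * x ^+ 2 <= 2 / e * (s ^+ 2 * (`|C'| * a z z)) * 4^-1 ^+ j.
  by rewrite -(mulrA (2 / e)) ler_wpM2l // divr_ge0 // ltW.
have p4 : (0 : R) <= 4^-1 ^+ j by rewrite exprn_ge0 // invr_ge0.
have xE : x = s * a (u_ j) z - s * a u z by rewrite /x siBl // mulrBr.
rewrite -/x in xE; lra.
Qed.

End Riesz.

Section CoerciveForm.
Context (R : realType) (V : lmodType R) (a b : V -> V -> R).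
Hypotheses (ha : semi_inner a) (hb : semi_inner b) (ca : complete_form a).

(** A form equivalent to a complete one is complete, so the representation
    theorem applies to it: the symmetric Lax-Milgram theorem. *)
Lemma lax_milgram (delta c : R) (l : V -> R) :
  0 < delta -> (forall u, delta * a u u <= b u u) ->
  (forall u, b u u <= c * a u u) ->
  (forall c u v, l (c *: u + v) = c * l u + l v) ->
  (exists C, forall u, l u ^+ 2 <= C * a u u) ->
  exists u, forall z, b u z = l z.
Proof.
move=> d0 lo up ll [C hC]; apply: riesz => //; last first.
  exists (`|C| / delta) => u; apply: le_trans (hC u) _.
  apply: (@le_trans _ _ (`|C| * a u u)).
    by rewrite ler_wpM2r ?ler_norm // (si_ge0 ha).
  by rewrite -mulrA ler_wpM2l // mulrC ler_pdivlMr // mulrC.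
move=> s [D hD].
have [|v [E hE]] := ca (s := s).
  exists (D / delta) => i j /hD h.
  have := le_trans (lo _) h; rewrite mulrC -ler_pdivlMr // => h'.
  by apply: le_trans h' _; rewrite mulrAC.
exists v, (`|c| * E) => i; apply: le_trans (up _) _.
apply: (@le_trans _ _ (`|c| * a (s i - v) (s i - v))).
  by rewrite ler_wpM2r ?ler_norm // (si_ge0 ha).
by rewrite -mulrA ler_wpM2l.
Qed.

End CoerciveForm.

(** * Operators with an adjoint *)

(** Null vectors are not quotiented out, so that the vectors can be actual
    processes. *)
Record semihilbert (R : realType) := SemiHilbert {
  vectors :> lmodType R;
  ip : vectors -> vectors -> R;
  ip_semi : semi_inner ip;
  ip_complete : complete_form ip }.

Definition eqv (R : realType) (V : semihilbert R) (u v : V) : Prop :=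
  forall z, ip u z = ip v z.

Infix "≈" := eqv (at level 70).

(** A function with an adjoint is linear up to [≈], see [adjoint_linear]. *)
Definition adjoint (R : realType) (V W : semihilbert R)
  (f : V -> W) (g : W -> V) : Prop := forall u z, ip (f u) z = ip u (g z).

Definition bounded_by (R : realType) (V W : semihilbert R)
  (c : R) (f : V -> W) : Prop := forall u, ip (f u) (f u) <= c * ip u u.

Section Operators.
Context (R : realType).
Implicit Types (V W Z : semihilbert R).

Definition ipE V := siE (ip_semi V).

Lemma ipC V (u v : V) : ip u v = ip v u.
Proof. exact: siC (ip_semi V) _ _. Qed.

Lemma ip_ge0 V (u : V) : 0 <= ip u u.
Proof. exact: si_ge0 (ip_semi V) _. Qed.

Lemma ip_null V (u : V) : ip u u <= 0 -> forall z, ip u z = 0.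
Proof. by move=> u0; apply: (si_null (ip_semi V)); apply/eqP; rewrite eq_le u0 ip_ge0. Qed.

Lemma eqvP V (u v : V) : u ≈ v <-> ip (u - v) (u - v) <= 0.
Proof.
split=> [uv|/ip_null h z]; first by rewrite (ipE V) uv subrr.
by apply/eqP; rewrite -subr_eq0 -(ipE V) h.
Qed.

Lemma eqvr V (u v z : V) : u ≈ v -> ip z u = ip z v.
Proof. by move=> uv; rewrite !(ipC z) uv. Qed.

Lemma adjointC V W (f : V -> W) g : adjoint f g -> adjoint g f.
Proof. by move=> fg u z; rewrite ipC -fg ipC. Qed.

Lemma adjoint_comp V W Z (f : V -> W) g (f' : W -> Z) g' :
  adjoint f g -> adjoint f' g' -> adjoint (f' \o f) (g \o g').
Proof. by move=> fg fg' u z; rewrite /= fg' fg. Qed.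

Lemma adjoint_add V W (f f' : V -> W) g g' :
  adjoint f g -> adjoint f' g' -> adjoint (f \+ f') (g \+ g').
Proof. by move=> fg fg' u z; rewrite /= (ipE W) (ipE V) fg fg'. Qed.

Lemma adjoint_linear V W (f : V -> W) g : adjoint f g ->
  forall c u v z, ip (f (c *: u + v)) z = c * ip (f u) z + ip (f v) z.
Proof. by move=> fg c u v z; rewrite !fg !(ipE V). Qed.

Lemma adjointB V W (f : V -> W) g : adjoint f g ->
  forall u v, f (u - v) ≈ f u - f v.
Proof. by move=> fg u v z; rewrite (ipE W) !fg (ipE V). Qed.

Lemma adjointD V W (f : V -> W) g : adjoint f g ->
  forall u v, f (u + v) ≈ f u + f v.
Proof. by move=> fg u v z; rewrite (ipE W) !fg (ipE V). Qed.

Lemma adjoint_eqv V W (f : V -> W) g : adjoint f g ->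
  forall u v, u ≈ v -> f u ≈ f v.
Proof. by move=> fg u v uv z; rewrite !fg uv. Qed.

Lemma bounded_by_le V W (c c' : R) (f : V -> W) : c <= c' ->
  bounded_by c f -> bounded_by c' f.
Proof.
by move=> cc' hf u; apply: le_trans (hf u) _; rewrite ler_wpM2r // ip_ge0.
Qed.

Lemma bounded_comp V W Z (c c' : R) (f : V -> W) (f' : W -> Z) : 0 <= c' ->
  bounded_by c f -> bounded_by c' f' -> bounded_by (c' * c) (f' \o f).
Proof.
move=> c0 hf hf' u; apply: le_trans (hf' (f u)) _.
by rewrite -mulrA ler_wpM2l //; exact: hf.
Qed.

Lemma bounded_add V W (c c' : R) (f f' : V -> W) :
  bounded_by c f -> bounded_by c' f' -> bounded_by (2 * c + 2 * c') (f \+ f').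
Proof.
move=> hf hf' u; apply: le_trans (si_sqD_le (ip_semi W) _ _) _.
by have := hf u; have := hf' u; lra.
Qed.

(** By Cauchy-Schwarz in [|f u|^2 = <u, g (f u)>]. *)
Lemma bounded_adjoint V W (c : R) (f : V -> W) g : 0 <= c ->
  adjoint f g -> bounded_by c g -> bounded_by c f.
Proof.
move=> c0 fg hg u; have := ip_ge0 (f u); set s := ip (f u) (f u); rewrite le_eqVlt => /orP[/eqP s0|s0].
  by rewrite -s0 mulr_ge0 // ip_ge0.
have h : s ^+ 2 <= ip u u * (c * s).
  rewrite {1}/s fg; apply: le_trans (si_cauchy_schwarz (ip_semi V) _ _) _.
  by rewrite ler_wpM2l ?ip_ge0 //; exact: hg.
by rewrite -(ler_pM2r s0) -expr2 (le_trans h) // mulrA (mulrC c).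
Qed.

(** The value at [u] represents the functional [z |-> <u, g z>]. *)
Lemma adjoint_exists V W (c : R) (g : W -> V) :
  (forall k u v, g (k *: u + v) = k *: g u + g v) -> bounded_by c g ->
  exists f, adjoint f g.
Proof.
move=> gl gc.
suff /choice[f hf] : forall u, exists y, forall z, ip y z = ip u (g z) by exists f.
move=> u; apply: (riesz (ip_semi W) (@ip_complete _ W)) => [k w v|].
  by rewrite gl !(ipE V).
exists (ip u u * c) => z; apply: le_trans (si_cauchy_schwarz (ip_semi V) _ _) _.
by rewrite -mulrA ler_wpM2l ?ip_ge0 //; exact: gc.
Qed.

End Operators.

Section Resolvent.
Context (R : realType) (V : semihilbert R) (K K' : V -> V).
Hypotheses (KK' : adjoint K K') (Kq : bounded_by 3^-1 K').

(** If [K'] is a strict contraction then [id - K'] is bounded below, so the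
    form [ip (u - K' u) (z - K' z)] is coercive; representing [ip f] by it
    yields [u], and [u - K' u] solves the equation. *)
Lemma resolvent_exists f : exists y, y - K y ≈ f.
Proof.
pose b (u z : V) := ip (u - K' u) (z - K' z).
have K'lin := adjoint_linear (adjointC KK').
have hb : semi_inner b.
  split=> [c u v z|u v|u]; last exact: ip_ge0.
    by rewrite /b !(ipE V) !K'lin; ring.
  by rewrite /b ipC.
have d0 : (0 : R) < 6^-1 by rewrite invr_gt0.
have lo u : 6^-1 * ip u u <= b u u.
  have := si_sqD_le (ip_semi V) (u - K' u) (K' u); rewrite subrK => h.
  have := Kq u; rewrite /b; lra.
have up u : b u u <= 6 * ip u u.
  have := si_sqD_le (ip_semi V) u (- K' u); rewrite !(ipE V) opprK => h.
  have := ip_ge0 u; have := Kq u; rewrite /b !(ipE V); lra.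
have [|| u hu] := @lax_milgram _ _ (@ip _ V) b (ip_semi V) hb (@ip_complete _ V)
    6^-1 6 (ip f) d0 lo up.
- by move=> c u v; rewrite !(ipE V).
- by exists (ip f f) => u; exact: si_cauchy_schwarz (ip_semi V) _ _.
exists (u - K' u) => z.
by rewrite -hu /b (siBr (ip_semi V)) -KK' [LHS](siBl (ip_semi V)).
Qed.

Lemma resolvent_inj u : u - K u ≈ 0 -> u ≈ 0.
Proof.
have hK : bounded_by 3^-1 K by apply: (bounded_adjoint _ KK'); rewrite ?invr_ge0.
move=> /eqvP; rewrite subr0 => h; apply/eqvP; rewrite subr0.
have := si_sqD_le (ip_semi V) (u - K u) (K u); rewrite subrK => h2.
have := hK u; have := ip_ge0 u; lra.
Qed.

Lemma resolvent_unique f y z : y - K y ≈ f -> z - K z ≈ f -> y ≈ z.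
Proof.
move=> hy hz; apply/eqvP.
have yz0 : y - z ≈ 0.
  apply: resolvent_inj => t; have := hy t; rewrite -hz.
  by rewrite !(ipE V) (adjointB KK') !(ipE V); lra.
by rewrite yz0 (si0l (ip_semi V)).
Qed.

End Resolvent.

(** The bound 6 comes from [|L f|^2 <= 2 |L f - K (L f)|^2 + 2 |K (L f)|^2]. *)
Lemma resolvent_adjoint (R : realType) (V : semihilbert R) (K K' : V -> V) :
  adjoint K K' -> bounded_by 3^-1 K' ->
  exists L L', [/\ adjoint L L', bounded_by 6 L,
    forall f, L f - K (L f) ≈ f & forall f, L' f - K' (L' f) ≈ f].
Proof.
move=> KK' hK'.
have hK : bounded_by 3^-1 K by apply: (bounded_adjoint _ KK'); rewrite ?invr_ge0.
have /choice[L hL] := resolvent_exists KK' hK'.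
have /choice[L' hL'] := resolvent_exists (adjointC KK') hK.
exists L, L'; split=> // [f z|f].
  by rewrite -(eqvr _ (hL' z)) (ipE V) -KK' -(ipE V) hL.
have := si_sqD_le (ip_semi V) (L f - K (L f)) (K (L f)); rewrite subrK hL (eqvr _ (hL f)).
have := hK (L f); lra.
Qed.

(** * The linear-quadratic problem in operator form *)

Section OperatorLQ.
Context (R : realType) (V U : semihilbert R).
Context (K K' : V -> V) (KK' : adjoint K K') (hK' : bounded_by 3^-1 K').
Context (C : U -> V) (C' : V -> U) (CC' : adjoint C C').
Context (c : R) (c0 : 0 <= c) (hC : bounded_by c C).
Context (N : V -> V) (NN : adjoint N N) (N_ge0 : forall y, 0 <= ip (N y) y).
Context (cN : R) (cN0 : 0 <= cN) (hN : bounded_by cN N).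
Context (W : U -> U) (WW : adjoint W W).
Context (cW : R) (cW0 : 0 <= cW) (hW : bounded_by cW W).
Context (delta : R) (delta0 : 0 < delta).
Hypothesis W_ge : forall v, delta * ip v v <= ip (W v) v.

(** Stationarity of [(<N y, y> + <W v, v>) / 2] on the constraint
    [y - K y = C v + f], with Lagrange multiplier [x]. *)
Definition optimality_system (f : V) (x y : V) (v : U) : Prop :=
  [/\ y - K y ≈ C v + f, x - K' x ≈ - N y & W v ≈ C' x].

(** Eliminating [y] and [x] by the resolvents leaves an equation for [v] whose
    operator is [W] plus the nonnegative [C' L' N L C]. *)
Lemma optimality_system_exists f : exists x y v, optimality_system f x y v.
Proof.
have [L [L' [LL' hL LK LK']]] := resolvent_adjoint KK' hK'.
pose F := (C' \o L') \o (N \o (L \o C)).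
have FF : adjoint F F.
  have CL := adjoint_comp CC' LL'.
  have := adjoint_comp (adjoint_comp CL NN) (adjointC CL).
  by [].
have F_ge0 v : 0 <= ip (F v) v by rewrite /F /= (adjointC CC') (adjointC LL').
pose G := F \+ W.
have GG : adjoint G G by exact: adjoint_add.
have G_ge v : delta * ip v v <= ip (G v) v.
  by rewrite /G /= (ipE U); have := F_ge0 v; have := W_ge v; lra.
have hb : semi_inner (fun u v => ip (G u) v).
  split; first exact: (adjoint_linear GG).
    by move=> u v; rewrite GG ipC.
  by move=> u; apply: le_trans (G_ge u); rewrite mulr_ge0 ?ip_ge0 // ltW.
have L'6 : bounded_by 6 L' by apply: (bounded_adjoint _ (adjointC LL')).
have hC' : bounded_by c C' by apply: (bounded_adjoint _ (adjointC CC')).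
have [g g0 hg] : exists2 g, 0 <= g & bounded_by g G.
  exists (2 * ((c * 6) * (cN * (6 * c))) + 2 * cW).
    by rewrite addr_ge0 // ?mulr_ge0 // mulr_ge0.
  apply: bounded_add => //; apply: bounded_comp; rewrite ?mulr_ge0 //.
    by apply: bounded_comp => //; exact: bounded_comp.
  exact: bounded_comp.
have up u : ip (G u) u <= (g + 1) * ip u u.
  have := ip_ge0 (G u - u); have := hg u; have := mulr_ge0 g0 (ip_ge0 u).
  have := ip_ge0 u; move: (G u) => Gu.
  rewrite !(ipE U) (ipC u Gu); lra.
have [|| v hv] := lax_milgram (ip_semi U) hb (@ip_complete _ U)
    (l := fun z => ip (- C' (L' (N (L f)))) z) delta0 G_ge up.
- by move=> k u v; rewrite !(ipE U); ring.
- eexists => u; exact: si_cauchy_schwarz (ip_semi U) _ _.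
pose y := L (C v + f).
exists (L' (- N y)), y, v; split; [exact: LK|exact: LK'|move=> z].
have yE : ip (C' (L' (N y))) z = ip (F v) z + ip (C' (L' (N (L f)))) z.
  rewrite /F /= !(adjointC CC') !(adjointC LL') !NN /y (adjointD LL').
  by rewrite (ipE V).
rewrite (adjointC CC') (adjointC LL') (ipE V) -(adjointC LL') -(adjointC CC') yE.
by have := hv z; rewrite /G /= !(ipE U); lra.
Qed.

(** The differences satisfy [<W v, v> = - <N y, y>], where the left side is
    nonnegative and the right side nonpositive. *)
Lemma optimality_system_unique f x1 y1 v1 x2 y2 v2 :
  optimality_system f x1 y1 v1 -> optimality_system f x2 y2 v2 ->
  [/\ x1 ≈ x2, y1 ≈ y2 & v1 ≈ v2].
Proof.
move=> [Hy1 Hx1 Hv1] [Hy2 Hx2 Hv2].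
have hK : bounded_by 3^-1 K by apply: (bounded_adjoint _ KK'); rewrite ?invr_ge0.
pose x := x1 - x2; pose y := y1 - y2; pose v := v1 - v2.
have Hy z : ip y z - ip (K y) z = ip (C v) z.
  have := Hy1 z; have := Hy2 z.
  by rewrite /y /v (adjointB KK') (adjointB CC') !(ipE V); lra.
have Hx z : ip x z - ip (K' x) z = - ip (N y) z.
  have := Hx1 z; have := Hx2 z.
  by rewrite /y /x (adjointB (adjointC KK')) (adjointB NN) !(ipE V); lra.
have Hv z : ip (W v) z = ip (C' x) z.
  have := Hv1 z; have := Hv2 z.
  by rewrite /x /v (adjointB (adjointC CC')) (adjointB WW) !(ipE U); lra.
have WvN : ip (W v) v = - ip (N y) y.
  by rewrite Hv (adjointC CC') -(ipC (C v)) -Hy -Hx (ipC y) KK' (ipC y).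
have v0 : ip v v <= 0.
  have := W_ge v; rewrite WvN; have := N_ge0 y => n0 w0.
  have : delta * ip v v <= 0 by lra.
  by rewrite pmulr_rle0.
have v00 : v1 ≈ v2 by apply/eqvP.
have y0 : y ≈ 0.
  apply: (resolvent_inj KK' hK') => z; rewrite (ipE V) Hy.
  rewrite CC' (ip_null v0) (ipE V) //.
have x0 : x ≈ 0.
  apply: (resolvent_inj (adjointC KK') hK) => z; rewrite (ipE V) Hx NN y0.
  by rewrite !(ipE V) oppr0.
have sub0 (a b : V) : a - b ≈ 0 -> a ≈ b.
  move=> h z; apply/eqP; rewrite -subr_eq0 -(ipE V) h (ipE V) //.
by split; [exact: sub0|exact: sub0|].
Qed.

(** Around a solution of the optimality system the cost has no linear term, and
    its second-order term in the control is at least [delta |u - v|^2]. *)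
Lemma optimality_system_minimal f x y v u e :
  optimality_system f x y v -> e - K e ≈ C u + f ->
  ip (N y) y + ip (W v) v + delta * ip (u - v) (u - v)
    <= ip (N e) e + ip (W u) u.
Proof.
move=> [Hy Hx Hv] He.
have [z zE] : exists z, z = e - y by eexists.
have [h hE] : exists h, h = u - v by eexists.
have Hz t : ip z t - ip (K z) t = ip (C h) t.
  have := Hy t; have := He t.
  by rewrite zE hE (adjointB KK') (adjointB CC') !(ipE V); lra.
have lin : ip (N y) z = - ip (W v) h.
  have Hxt t : ip x t - ip (K' x) t = - ip (N y) t by have := Hx t; rewrite !(ipE V).
  have := Hxt z; rewrite Hv (adjointC CC') -(ipC (C h)) -Hz (ipC z) KK' (ipC z); lra.
have eE : ip (N e) e = ip (N y) y + 2 * ip (N y) z + ip (N z) z.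
  rewrite -[e](subrK y) -zE (adjointD NN) !(ipE V) (NN z y) (ipC z); ring.
have uE : ip (W u) u = ip (W v) v + 2 * ip (W v) h + ip (W h) h.
  rewrite -[u](subrK v) -hE (adjointD WW) !(ipE U) (WW h v) (ipC h); ring.
rewrite eE uE lin; have := N_ge0 z; have := W_ge h; rewrite -hE; lra.
Qed.

End OperatorLQ.

(** * Square-integrable random vectors *)

Section Inner.
Context (R : realType) (n : nat).
Implicit Types u v : 'cV[R]_n.

Lemma innerE u v : inner u v = \sum_i u i ord0 * v i ord0.
Proof. by rewrite /inner mxE; apply: eq_bigr => i _; rewrite mxE. Qed.

Lemma inner_semi : semi_inner (@inner R n).
Proof.
split=> [c u v z|u v|u]; rewrite !innerE.
- rewrite mulr_sumr -big_split; apply: eq_bigr => i _ /=; rewrite !mxE; ring.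
- by apply: eq_bigr => i _; rewrite mulrC.
- by apply: sumr_ge0 => i _; rewrite -expr2 sqr_ge0.
Qed.

Lemma inner_ge0 u : 0 <= inner u u. Proof. exact: si_ge0 inner_semi _. Qed.

Lemma inner_eq0 u : inner u u <= 0 -> u = 0.
Proof.
rewrite innerE => h; apply/matrixP => i j; rewrite ord1 mxE.
have /psumr_eq0P : forall i, true -> 0 <= u i ord0 * u i ord0.
  by move=> k _; rewrite -expr2 sqr_ge0.
have s0 : \sum_i u i ord0 * u i ord0 = 0.
  by apply/eqP; rewrite eq_le h sumr_ge0 // => k _; rewrite -expr2 sqr_ge0.
by move=> /(_ s0) /(_ i isT) /eqP; rewrite mulf_eq0 orbb => /eqP.
Qed.

Lemma frob_inner u : frob_norm u ^+ 2 = inner u u.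
Proof.
have e : \tr (u *m u^T) = inner u u by rewrite mxtrace_mulC /mxtrace big_ord1.
by rewrite /frob_norm e sqr_sqrtr // inner_ge0.
Qed.

Lemma norm_inner_le u v : `|inner u v| <= inner u u + inner v v.
Proof.
have := inner_ge0 (u + v); have := inner_ge0 (u - v).
have := inner_ge0 u; have := inner_ge0 v.
rewrite !(siE inner_semi) (siC inner_semi v u) ler_norml.
by move=> h1 h2 h3 h4; apply/andP; split; lra.
Qed.

End Inner.

Lemma inner_mulmx (R : realType) (n m : nat) (X : 'M[R]_(m, n))
    (u : 'cV[R]_n) (v : 'cV[R]_m) : inner (X *m u) v = inner u (X^T *m v).
Proof. by rewrite /inner trmx_mul mulmxA. Qed.

Section RandomVectors.
Context d (T : measurableType d) (R : realType) (P : probability T R) (n : nat).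
Implicit Types u v : T -> 'cV[R]_n.

Definition random_vector u := forall i, measurable_fun setT (fun t => u t i ord0).

Definition square_integrable u :=
  random_vector u /\ (\int[P]_t (inner (u t) (u t))%:E < +oo)%E.

Definition mean_inner u v : R := (\int[P]_t inner (u t) (v t))%R.

Lemma measurable_inner u v : random_vector u -> random_vector v ->
  measurable_fun setT (fun t => inner (u t) (v t)).
Proof.
move=> mu mv; under eq_fun do rewrite innerE.
apply: measurable_sum => i; exact: measurable_funM.
Qed.

Lemma integrable_inner u v : square_integrable u -> square_integrable v ->
  P.-integrable setT (fun t => (inner (u t) (v t))%:E).
Proof.
move=> [mu iu] [mv iv].
have sq w : random_vector w -> (\int[P]_t (inner (w t) (w t))%:E < +oo)%E ->
    P.-integrable setT (fun t => (inner (w t) (w t))%:E).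
  move=> mw iw; apply/integrableP; split.
    by apply/measurable_EFinP; exact: measurable_inner.
  under eq_integral do rewrite gee0_abs ?lee_fin ?inner_ge0 //. exact: iw.
apply: (le_integrable measurableT) (integrableD measurableT (sq u mu iu) (sq v mv iv)).
  by apply/measurable_EFinP; exact: measurable_inner.
move=> t _ /=; rewrite lee_fin [leRHS]ger0_norm ?addr_ge0 ?inner_ge0 //.
exact: norm_inner_le.
Qed.

Lemma mean_innerE u v : square_integrable u -> square_integrable v ->
  (\int[P]_t (inner (u t) (v t))%:E)%E = (mean_inner u v)%:E.
Proof.
move=> hu hv; rewrite /mean_inner /Rintegral fineK //.
by apply: integrable_fin_num => //; exact: integrable_inner.
Qed.

Lemma square_integrable_lin c u v : square_integrable u -> square_integrable v ->
  square_integrable (c *: u + v).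
Proof.
move=> hu hv; have [mu iu] := hu; have [mv iv] := hv.
have m : random_vector (c *: u + v).
  move=> i; apply: (eq_measurable_fun (fun t => c * u t i ord0 + v t i ord0)).
    by move=> t _; rewrite !mxE.
  by apply: measurable_funD => //; exact: measurable_funM.
split=> //.
have iu2 := integrableZl measurableT (2 * c ^+ 2) (integrable_inner hu hu).
have iv2 := integrableZl measurableT 2 (integrable_inner hv hv).
have := integrableD measurableT iu2 iv2 => /integrableP[_]; apply: le_lt_trans.
apply: ge0_le_integral => //.
- by move=> t _; rewrite lee_fin inner_ge0.
- by apply/measurable_EFinP; exact: measurable_inner.
- apply: measurableT_comp => //; apply/measurable_EFinP.
  by apply: measurable_funD; apply: measurable_funM => //; exact: measurable_inner.
move=> t _ /=; rewrite lee_fin; apply: le_trans (ler_norm _).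
apply: le_trans (si_sqD_le (inner_semi R n) (c *: u t) (v t)) _.
by rewrite !(siE (inner_semi R n)) expr2 !mulrA.
Qed.

Lemma square_integrable0 : square_integrable (0 : T -> 'cV[R]_n).
Proof.
split=> [i|]; first by under eq_fun do rewrite mxE; exact: measurable_cst.
by under eq_integral do rewrite (si0l (inner_semi R n)); rewrite integral0.
Qed.

Lemma mean_inner_lin c u v z :
  square_integrable u -> square_integrable v -> square_integrable z ->
  mean_inner (c *: u + v) z = c * mean_inner u z + mean_inner v z.
Proof.
move=> hu hv hz; rewrite /mean_inner.
under eq_Rintegral do rewrite (siPl (inner_semi R n)).
have iu := integrable_inner hu hz; have iv := integrable_inner hv hz.
rewrite RintegralD ?RintegralZl //.
exact: (integrableZl measurableT c iu).
Qed.

Lemma mean_innerC u v : mean_inner u v = mean_inner v u.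
Proof. by apply: eq_Rintegral => t _; rewrite (siC (inner_semi R n)). Qed.

Lemma mean_inner_ge0 u : 0 <= mean_inner u u.
Proof. by apply: Rintegral_ge0 => t _; exact: inner_ge0. Qed.

Lemma norm_mean_inner_le u v : square_integrable u -> square_integrable v ->
  `|mean_inner u v| <= mean_inner u u + mean_inner v v.
Proof.
move=> hu hv; have iuv := integrable_inner hu hv.
apply: le_trans (le_normr_Rintegral _ iuv) _ => //.
rewrite /mean_inner -RintegralD //; [|exact: integrable_inner..].
apply: le_Rintegral => //.
- exact: integrable_norm.
- exact: (integrableD measurableT (integrable_inner hu hu) (integrable_inner hv hv)).
- by move=> t _; exact: norm_inner_le.
Qed.

Lemma eq_mean_inner u u' v : u = u' %[ae P] -> random_vector u -> random_vector u' ->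
  random_vector v -> mean_inner u v = mean_inner u' v.
Proof.
move=> uu' mu mu' mv; congr fine; apply: ae_eq_integral => //.
- by apply/measurable_EFinP; exact: measurable_inner.
- by apply/measurable_EFinP; exact: measurable_inner.
by apply: filterS uu' => t /= h _; rewrite h.
Qed.

Lemma mean_inner_eq0 u : square_integrable u -> mean_inner u u <= 0 ->
  u = 0 %[ae P].
Proof.
move=> hu h; have [mu _] := hu.
have mi : measurable_fun setT (fun t => (inner (u t) (u t))%:E).
  by apply/measurable_EFinP; exact: measurable_inner.
have : (\int[P]_t `|(inner (u t) (u t))%:E| = 0)%E.
  under eq_integral do rewrite gee0_abs ?lee_fin ?inner_ge0 //.
  by rewrite mean_innerE //; congr EFin; apply/eqP; rewrite eq_le h mean_inner_ge0.
move/(ae_eq_integral_abs P measurableT mi); apply: filterS => t /(_ I) /= h0 _.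
by apply: inner_eq0; case: h0 => ->.
Qed.

End RandomVectors.

(** * Sub-sigma-algebras and the filtration *)

Section SubSigmaAlgebra.
Context d (T : measurableType d) (R : realType).

Lemma measurable_wrt_sub (G : set (set T)) (f : T -> R) :
  G `<=` measurable -> measurable_wrt G f -> measurable_fun setT f.
Proof.
move=> GT mf _ Y mY; have := mf measurableT Y mY.
by apply: (smallest_sub (sigma_algebra_measurable T) GT).
Qed.

Lemma measurable_wrtW (G H : set (set T)) (f : T -> R) :
  G `<=` H -> measurable_wrt G f -> measurable_wrt H f.
Proof.
move=> GH mf _ Y mY; have := mf measurableT Y mY.
exact: (sub_sigma_algebra2 GH).
Qed.

Lemma measurable_wrt_indic (G : set (set T)) (A : set T) :
  G A -> measurable_wrt G (\1_A : T -> R).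
Proof.
move=> GA; apply: (@measurable_indic _ (g_sigma_algebraType G) R setT A).
exact: sub_sigma_algebra.
Qed.

Lemma measurable_wrt_set (G : set (set T)) (f : T -> R) (Y : set R) :
  sigma_algebra setT G -> measurable_wrt G f -> measurable Y -> G (f @^-1` Y).
Proof.
move=> sG mf mY; have := mf measurableT Y mY.
by rewrite setTI -[X in _ -> X _](sigma_algebra_id sG).
Qed.

Variable w : nat -> T -> R.

Lemma sigma_algebra_past k : sigma_algebra setT (past w k).
Proof. exact: smallest_sigma_algebra. Qed.

Lemma past_noise k : measurable_wrt (past w k.+1) (w k).
Proof.
move=> _ Y mY; apply: sub_sigma_algebra; apply: sub_sigma_algebra.
by exists k => //=; exists Y.
Qed.

Lemma pastS k : past w k `<=` past w k.+1.
Proof.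
apply: sub_sigma_algebra2 => A [i /= ik Ai]; exists i => //=.
exact: ltn_trans ik _.
Qed.

Lemma past_measurable k : (forall i, measurable_fun setT (w i)) ->
  past w k `<=` measurable.
Proof.
move=> mw; apply: smallest_sub; first exact: sigma_algebra_measurable.
by move=> A [i _ [Y mY <-]]; exact: mw.
Qed.

End SubSigmaAlgebra.

(** * The Hilbert space of square-summable predictable processes *)

Section Series.
Context (R : realType).

Lemma nneseries_EFin (u : nat -> R) : (forall k, 0 <= u k) -> cvgn (series u) ->
  (\sum_(0 <= k <oo) (u k)%:E = (limn (series u))%:E)%E.
Proof.
move=> u0 cu; apply: cvg_lim => //.
under eq_fun do rewrite sumEFin.
by apply: cvg_EFin; [exact: nearW | exact: cu].
Qed.

Lemma partial_sum_le_lim (u : nat -> R) N : (forall k, 0 <= u k) -> cvgn (series u) ->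
  \sum_(0 <= k < N) u k <= limn (series u).
Proof.
move=> u0 cu; apply: (nondecreasing_cvgn_le (u_ := series u)) => //.
exact: nondecreasing_series.
Qed.

Lemma lim_series_bound (u : nat -> R) c : (forall k, 0 <= u k) ->
  (forall N, \sum_(0 <= k < N) u k <= c) ->
  cvgn (series u) /\ limn (series u) <= c.
Proof.
move=> u0 uc; have cu : cvgn (series u).
  apply: nondecreasing_is_cvgn; first exact: nondecreasing_series.
  by exists c => _ [N _ <-]; exact: uc.
by split=> //; apply: limr_le => //; apply: nearW => N; exact: uc.
Qed.

End Series.

Section Processes.
Context d (T : measurableType d) (R : realType) (P : probability T R)
  (w : nat -> T -> R) (rho : R).

Definition weight k : R := expR (- rho * k%:R).

Lemma weight_gt0 k : 0 < weight k. Proof. exact: expR_gt0. Qed.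
Lemma weight_ge0 k : 0 <= weight k. Proof. exact: expR_ge0. Qed.
Lemma weightS k : expR rho * weight k.+1 = weight k.
Proof. by rewrite /weight -expRD; congr expR; rewrite -addn1 natrD; ring. Qed.

Definition process_term n (g h : process T R n 1) k : R :=
  weight k * mean_inner P (g k) (h k).

Definition process_ip n (g h : process T R n 1) : R :=
  limn (series (process_term g h)).

Hypothesis mw : forall k, measurable_fun setT (w k).

Section Dim.
Context (n : nat).
Implicit Types g h : process T R n 1.

Lemma predictable_random_vector g k : predictable w g -> random_vector (g k).
Proof.
by move=> pg i; apply: measurable_wrt_sub (pg k i ord0); exact: past_measurable.
Qed.

Lemma process_term_ge0 g k : 0 <= process_term g g k.
Proof. by rewrite mulr_ge0 ?weight_ge0 ?mean_inner_ge0. Qed.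

(** By Tonelli the norm is a series of real numbers, for which limits and
    bilinearity are elementary. *)
Lemma L2rhoP g : L2rho P w rho g <->
  [/\ predictable w g, forall k, square_integrable P (g k)
    & cvgn (series (process_term g g))].
Proof.
have eqS : predictable w g -> (\int[P]_t (\sum_(0 <= k <oo)
     (expR (- rho * k%:R) * frob_norm (g k t) ^+ 2)%:E) =
     \sum_(0 <= k <oo) ((weight k)%:E * \int[P]_t (inner (g k t) (g k t))%:E))%E.
  move=> pg; rewrite integral_nneseries //.
  - apply: eq_eseriesr => k _; rewrite -ge0_integralZl_EFin //.
    + by apply: eq_integral => t _; rewrite frob_inner EFinM.
    + by move=> t _; rewrite lee_fin inner_ge0.
    + by apply/measurable_EFinP; apply: measurable_inner; exact: predictable_random_vector.
    + exact: weight_ge0.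
  - move=> k; apply/measurable_EFinP; apply: measurable_funM => //.
    under eq_fun do rewrite frob_inner.
    by apply: measurable_inner; exact: predictable_random_vector.
  - by move=> k t _; rewrite lee_fin mulr_ge0 ?expR_ge0 ?sqr_ge0.
have int0 k : (0 <= \int[P]_t (inner (g k t) (g k t))%:E)%E.
  by apply: integral_ge0 => t _; rewrite lee_fin inner_ge0.
split=> [[pg]|[pg sg cg]].
  rewrite eqS // => fin.
  have sg k : square_integrable P (g k).
    split; first exact: predictable_random_vector.
    have : ((weight k)%:E * \int[P]_t (inner (g k t) (g k t))%:E < +oo)%E.
      apply: le_lt_trans fin.
      rewrite (@nneseriesD1 _ _ k) // => [|i _].
        by rewrite leeDl // nneseries_ge0 // => i _ _; rewrite mule_ge0 ?lee_fin ?weight_ge0.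
      by rewrite mule_ge0 ?lee_fin ?weight_ge0.
    case: (\int[P]_t _)%E (int0 k) => [r _ _|_|//]; first exact: ltry.
    by rewrite gt0_muley // lte_fin weight_gt0.
  split=> //; apply: nnseries_is_cvg => [k|]; first exact: process_term_ge0.
  apply: le_lt_trans fin; apply: lee_nneseries => k _ //.
    by rewrite lee_fin process_term_ge0.
  by rewrite /process_term EFinM mean_innerE.
split=> //; rewrite eqS //.
under eq_eseriesr do rewrite mean_innerE // -EFinM.
rewrite nneseries_EFin ?ltry // => k; exact: process_term_ge0.
Qed.

End Dim.
End Processes.

Section InnerProduct.
Context d (T : measurableType d) (R : realType) (P : probability T R)
  (w : nat -> T -> R) (rho : R).
Hypothesis mw : forall k, measurable_fun setT (w k).
Context (n : nat).
Implicit Types g h : process T R n 1.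

Notation pterm := (process_term P rho).
Notation pip := (process_ip P rho).
Notation L2 := (L2rho P w rho).

Lemma L2rho_square_integrable g k : L2 g -> square_integrable P (g k).
Proof. by case/(L2rhoP P rho mw). Qed.

Lemma predictable_lin c g h : predictable w g -> predictable w h ->
  predictable w (c *: g + h).
Proof.
move=> pg ph k i j.
apply: (eq_measurable_fun (fun t : g_sigma_algebraType (past w k) => c * g k t i j + h k t i j)).
  by move=> t _; rewrite !mxE.
apply: measurable_funD; last exact: ph.
by apply: measurable_funM; [exact: measurable_cst|exact: pg].
Qed.

Lemma process_termC g h : pterm g h = pterm h g.
Proof. by apply/funext => k; rewrite /process_term mean_innerC. Qed.

Lemma process_term_lin c g h z k : L2 g -> L2 h -> square_integrable P (z k) ->
  pterm (c *: g + h) z k = c * pterm g z k + pterm h z k.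
Proof.
move=> hg hh hz; rewrite /process_term.
rewrite -[(c *: g + h) k]/(c *: g k + h k) (mean_inner_lin c (L2rho_square_integrable k hg) (L2rho_square_integrable k hh) hz).
by ring.
Qed.

Lemma process_term_cvg g h : L2 g -> L2 h -> cvgn (series (pterm g h)).
Proof.
move=> hg hh; have /(L2rhoP P rho mw) [_ sg cg] := hg.
have /(L2rhoP P rho mw) [_ sh ch] := hh.
apply: normed_cvg.
apply: (@series_le_cvg _ _ (pterm g g + pterm h h)).
- by move=> k; exact: normr_ge0.
- by move=> k; rewrite addr_ge0 ?process_term_ge0.
- move=> k; rewrite /= /process_term normrM ger0_norm ?weight_ge0 //.
  by rewrite -mulrDr ler_wpM2l ?weight_ge0 // norm_mean_inner_le.
- exact: (is_cvg_seriesD cg ch).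
Qed.

Lemma L2rho_lin c g h : L2 g -> L2 h -> L2 (c *: g + h).
Proof.
move=> hg hh; have /(L2rhoP P rho mw) [pg sg cg] := hg.
have /(L2rhoP P rho mw) [ph sh ch] := hh; apply/(L2rhoP P rho mw).
have sl k : square_integrable P ((c *: g + h) k) by exact: square_integrable_lin.
split; [exact: predictable_lin|exact: sl|].
have -> : pterm (c *: g + h) (c *: g + h) =
    c *: (c *: pterm g g + pterm h g) +
    (c *: pterm g h + pterm h h).
  apply/funext => k; rewrite process_term_lin //.
  by rewrite !(process_termC _ (c *: g + h)) !process_term_lin.
have cs := process_term_cvg.
apply: is_cvg_seriesD; [apply: is_cvg_seriesZ|]; apply: is_cvg_seriesD.
- by apply: is_cvg_seriesZ; exact: cs.
- exact: cs.
- by apply: is_cvg_seriesZ; exact: cs.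
- exact: cs.
Qed.

Lemma L2rho0 : L2 (0 : process T R n 1).
Proof.
apply/(L2rhoP P rho mw).
have t0 : pterm (0 : process T R n 1) 0 = 0.
  apply/funext => k; rewrite /process_term /mean_inner.
  under eq_Rintegral do rewrite (si0l (inner_semi R n)).
  by rewrite Rintegral_cst // mul0r mulr0.
split=> [k i j|k|].
- by apply: eq_measurable_fun (measurable_cst (0 : R)) => t _; rewrite mxE.
- exact: square_integrable0.
- rewrite t0 (_ : series 0 = 0); first exact: is_cvg_cst.
  by apply/funext => N; rewrite /series /= big1.
Qed.

Lemma process_ip_lin c g h z : L2 g -> L2 h -> L2 z ->
  pip (c *: g + h) z = c * pip g z + pip h z.
Proof.
move=> hg hh hz; rewrite /process_ip.
have -> : pterm (c *: g + h) z = c *: pterm g z + pterm h z.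
  by apply/funext => k; rewrite process_term_lin //; exact: L2rho_square_integrable.
have cg := process_term_cvg hg hz; have ch := process_term_cvg hh hz.
by rewrite (lim_seriesD (@is_cvg_seriesZ _ _ c cg) ch) (@lim_seriesZ _ _ c cg).
Qed.

Lemma process_ipC g h : pip g h = pip h g.
Proof. by rewrite /process_ip process_termC. Qed.

Lemma process_ip_ge0 g : L2 g -> 0 <= pip g g.
Proof.
move=> hg; apply: limr_ge; first exact: process_term_cvg.
by apply: nearW => N; apply: sumr_ge0 => k _; exact: process_term_ge0.
Qed.

Lemma process_term_le_ip g k : L2 g -> pterm g g k <= pip g g.
Proof.
move=> hg; have := partial_sum_le_lim k.+1 (process_term_ge0 P rho g) (process_term_cvg hg hg).
apply: le_trans; rewrite big_nat_recr //= lerDr sumr_ge0 // => i _.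
exact: process_term_ge0.
Qed.

(** Tonelli's theorem for a pointwise nonnegative pairing: besides squares this
    covers the quadratic terms of the cost. *)
Lemma integral_process_ip g h : L2 g -> L2 h -> (forall k t, 0 <= inner (g k t) (h k t)) ->
  (\int[P]_t (\sum_(0 <= k <oo) (expR (- rho * k%:R) * inner (g k t) (h k t))%:E) =
   (pip g h)%:E)%E.
Proof.
move=> hg hh gh0; have sg k := L2rho_square_integrable k hg.
have sh k := L2rho_square_integrable k hh.
have mi k : measurable_fun setT (fun t => inner (g k t) (h k t)).
  by apply: measurable_inner; [case: (sg k)|case: (sh k)].
rewrite integral_nneseries //; last 2 first.
- by move=> k; apply/measurable_EFinP; apply: measurable_funM.
- by move=> k t _; rewrite lee_fin mulr_ge0 ?expR_ge0.
rewrite -nneseries_EFin //; last 2 first.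
- by move=> k; rewrite mulr_ge0 ?weight_ge0 // Rintegral_ge0.
- exact: process_term_cvg.
apply: eq_eseriesr => k _; rewrite /process_term EFinM -mean_innerE //.
rewrite -ge0_integralZl_EFin ?weight_ge0 //.
- by move=> t _; rewrite lee_fin.
- exact/measurable_EFinP.
Qed.

Lemma process_ip_null g : L2 g -> pip g g <= 0 -> ae_same P g 0.
Proof.
move=> hg g0 k; apply: mean_inner_eq0; first exact: L2rho_square_integrable.
rewrite -(ler_pM2l (weight_gt0 rho k)) mulr0.
exact: le_trans (process_term_le_ip k hg) g0.
Qed.

Lemma eq_process_ip g g' h : ae_same P g g' -> predictable w g -> predictable w g' ->
  predictable w h -> pip g h = pip g' h.
Proof.
move=> gg' pg pg' ph; rewrite /process_ip; congr (limn (series _)).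
apply/funext => k; rewrite /process_term; congr (_ * _).
by apply: eq_mean_inner; [exact: gg'|exact: predictable_random_vector..].
Qed.

End InnerProduct.

(** * Completeness *)

Section FastConvergence.
Context d (T : measurableType d) (R : realType) (P : probability T R).

(** The increments are summable in L^1, since [|x| <= 2^(-j) + 2^j x^2] and the
    total mass is 1; hence they are almost surely absolutely summable. *)
Lemma fast_ae_cvg (a : nat -> T -> R) (C : R) :
  (forall j, measurable_fun setT (a j)) ->
  (forall j, (\int[P]_t ((a j t - a j.+1 t) ^+ 2)%:E <= (C * 4^-1 ^+ j)%:E)%E) ->
  {ae P, forall t, cvgn (fun j => a j t)}.
Proof.
move=> ma hC; pose f j t := `|a j.+1 t - a j t|.
have mf j : measurable_fun setT (f j).
  by apply: measurableT_comp => //; exact: measurable_funB.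
have C0 : 0 <= C.
  have := hC 0%N; rewrite expr0 mulr1 -lee_fin; apply: le_trans.
  by apply: integral_ge0 => t _; rewrite lee_fin sqr_ge0.
have fle j : (\int[P]_t (f j t)%:E <= ((1 + C) * 2^-1 ^+ j)%:E)%E.
  have p2 : (0 : R) <= 2 ^+ j by rewrite exprn_ge0.
  have i2 : (2^-1 : R) ^+ j * 2 ^+ j = 1 by rewrite -exprMn mulVf // expr1n.
  have i20 : (0 : R) <= 2^-1 ^+ j by rewrite exprn_ge0 // invr_ge0.
  have e4 : (4^-1 : R) ^+ j = 2^-1 ^+ j * 2^-1 ^+ j.
    by rewrite -exprMn -invfM -natrM.
  have msq : measurable_fun setT (fun t => (a j t - a j.+1 t) ^+ 2).
    by apply: measurable_funX; exact: measurable_funB.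
  apply: (@le_trans _ _ (\int[P]_t ((2^-1 ^+ j)%:E + (2 ^+ j)%:E * ((a j t - a j.+1 t) ^+ 2)%:E))%E).
    apply: ge0_le_integral => //.
    - by move=> t _; rewrite lee_fin normr_ge0.
    - exact/measurable_EFinP.
    - apply: emeasurable_funD => //.
      apply: measurable_funeM; exact/measurable_EFinP.
    move=> t _; rewrite -EFinM -EFinD lee_fin /f distrC -(real_normK (num_real (a j t - _))).
    set x := `| _ |; have x0 : 0 <= x by exact: normr_ge0.
    have := sqr_ge0 (x * 2 ^+ j - 1).
    have [xl _|xg _] := lerP x (2^-1 ^+ j).
      by rewrite (le_trans xl) // lerDl mulr_ge0 // sqr_ge0.
    have : x * 1 <= x * (2 ^+ j * x).
      by rewrite ler_wpM2l // -[leLHS]i2 [leLHS]mulrC ler_wpM2l // ltW.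
    rewrite mulr1 => h; rewrite (le_trans h) // [leRHS]addrC.
    by rewrite mulrCA -expr2 lerDl.
  rewrite ge0_integralD //; last 2 first.
  - by move=> t _; rewrite mule_ge0 ?lee_fin ?sqr_ge0.
  - by apply: measurable_funeM; exact/measurable_EFinP.
  have -> : (\int[P]_(t in setT) (2^-1 ^+ j)%:E = (2^-1 ^+ j)%:E)%E.
    rewrite integral_cst // -[RHS]mule1; congr (_ * _)%E; exact: probability_setT.
  rewrite ge0_integralZl_EFin //; last 2 first.
  - by move=> t _; rewrite lee_fin sqr_ge0.
  - exact/measurable_EFinP.
  rewrite mulrDl mul1r EFinD leeD2l //.
  apply: le_trans (lee_wpmul2l _ (hC j)) _; first by rewrite lee_fin.
  rewrite -EFinM lee_fin e4.
  have -> : 2 ^+ j * (C * (2^-1 ^+ j * 2^-1 ^+ j)) = C * 2^-1 ^+ j * (2^-1 ^+ j * 2 ^+ j) :> R by ring.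
  by rewrite i2 mulr1.
have fin : P.-integrable setT (fun t => \sum_(0 <= j <oo) (f j t)%:E)%E.
  have mS : measurable_fun setT (fun t => \sum_(0 <= j <oo) (f j t)%:E)%E.
    apply: ge0_emeasurable_sum => [k t _ _|k _]; first by rewrite lee_fin normr_ge0.
    exact/measurable_EFinP.
  apply/integrableP; split=> //.
  have S0 t : (0 <= \sum_(0 <= j <oo) (f j t)%:E)%E.
    by apply: nneseries_ge0 => k _ _; rewrite lee_fin normr_ge0.
  under eq_integral do rewrite (gee0_abs (S0 _)).
  rewrite integral_nneseries //; last 2 first.
  - by move=> k; exact/measurable_EFinP.
  - by move=> k t _; rewrite lee_fin normr_ge0.
  apply: (@le_lt_trans _ _ (\sum_(0 <= j <oo) ((1 + C) * 2^-1 ^+ j)%:E)%E).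
    by apply: lee_nneseries => [k _ _|k _]; [apply: integral_ge0 => t _; rewrite lee_fin normr_ge0|exact: fle].
  have g0 k : 0 <= (1 + C) * 2^-1 ^+ k.
    by rewrite mulr_ge0 ?addr_ge0 // exprn_ge0 // invr_ge0.
  have [|cu _] := @lim_series_bound _ (fun k => (1 + C) * 2^-1 ^+ k) (2 * (1 + C)) g0.
    move=> N; rewrite -mulr_sumr [leRHS]mulrC ler_wpM2l ?addr_ge0 //.
    suff -> : \sum_(0 <= i < N) (2^-1 : R) ^+ i = 2 - 2 * 2^-1 ^+ N.
      by rewrite gerBl mulr_ge0 // exprn_ge0 // invr_ge0.
    elim: N => [|N IH]; first by rewrite big_nil expr0 mulr1 subrr.
    by rewrite big_nat_recr //= IH exprS; field.
  by rewrite nneseries_EFin // ltry.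
have := integrable_ae measurableT fin; apply: filterS => t /(_ I) ft.
have cf : cvgn (series (fun j => a j.+1 t - a j t)).
  apply: normed_cvg; apply: nnseries_is_cvg => [k|]; first exact: normr_ge0.
  by case/fin_numP : ft => _; rewrite -ltey.
have -> : (fun j => a j t) = (fun j => a 0%N t + series (fun j => a j.+1 t - a j t) j).
  by apply/funext => j; rewrite /series /= telescope_sumr // addrC subrK.
by apply: is_cvgD => //; exact: is_cvg_cst.
Qed.

End FastConvergence.

Section Completeness.
Context d (T : measurableType d) (R : realType) (P : probability T R)
  (w : nat -> T -> R) (rho : R).
Hypothesis mw : forall k, measurable_fun setT (w k).
Context (n : nat).
Implicit Types g h : process T R n 1.

Notation pterm := (process_term P rho).
Notation pip := (process_ip P rho).
Notation wt := (weight rho).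
Notation L2 := (L2rho P w rho).

Definition partial_energy g N t : R :=
  \sum_(0 <= k < N) wt k * inner (g k t) (g k t).

Lemma integral_partial_energy g N : predictable w g ->
  (\int[P]_t (partial_energy g N t)%:E =
   \sum_(0 <= k < N) (wt k)%:E * \int[P]_t (inner (g k t) (g k t))%:E)%E.
Proof.
move=> pg; have mi k : measurable_fun setT (fun t => inner (g k t) (g k t)).
  by apply: measurable_inner; exact: predictable_random_vector.
under eq_integral do rewrite /partial_energy -sumEFin.
rewrite ge0_integral_sum //.
- apply: eq_bigr => k _; rewrite -ge0_integralZl_EFin ?weight_ge0 //.
  + by move=> t _; rewrite lee_fin inner_ge0.
  + exact/measurable_EFinP.
- by move=> k; apply/measurable_EFinP; apply: measurable_funM.
- by move=> k t _; rewrite lee_fin mulr_ge0 ?weight_ge0 ?inner_ge0.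
Qed.

(** Partial sums of the norm are accessible to Fatou's lemma and to termwise
    computation, so membership and norm bounds are both reduced to them. *)
Lemma L2rho_energy_bound g c : predictable w g ->
  (forall N, (\int[P]_t (partial_energy g N t)%:E <= c%:E)%E) ->
  L2 g /\ pip g g <= c.
Proof.
move=> pg hc.
have i0 k : (0 <= (wt k)%:E * \int[P]_t (inner (g k t) (g k t))%:E)%E.
  rewrite mule_ge0 ?lee_fin ?weight_ge0 //.
  by apply: integral_ge0 => t _; rewrite lee_fin inner_ge0.
have sg k : square_integrable P (g k).
  split; first exact: predictable_random_vector.
  have h : ((wt k)%:E * \int[P]_t (inner (g k t) (g k t))%:E < +oo)%E.
    apply: le_lt_trans (ltry c); apply: le_trans (hc k.+1).
    by rewrite integral_partial_energy // big_nat_recr //= leeDr // sume_ge0.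
  have : (0 <= \int[P]_t (inner (g k t) (g k t))%:E)%E.
    by apply: integral_ge0 => t _; rewrite lee_fin inner_ge0.
  case: (\int[P]_t _)%E h => [r _ _|h _|//]; first exact: ltry.
  by move: h; rewrite gt0_muley // lte_fin weight_gt0.
have [|cg le_c] := lim_series_bound (c := c) (process_term_ge0 P rho g).
  move=> N; have := hc N; rewrite integral_partial_energy // -lee_fin -sumEFin.
  by under eq_bigr do rewrite mean_innerE // -EFinM.
by split=> //; apply/(L2rhoP P rho mw).
Qed.

Lemma partial_energy_le_ip g N : L2 g ->
  (\int[P]_t (partial_energy g N t)%:E <= (pip g g)%:E)%E.
Proof.
move=> hg; have [pg _] := hg; rewrite integral_partial_energy //.
under eq_bigr do rewrite (mean_innerE (L2rho_square_integrable mw _ hg)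
  (L2rho_square_integrable mw _ hg)) -EFinM.
rewrite sumEFin lee_fin.
apply: (partial_sum_le_lim (u := pterm g g)); first exact: process_term_ge0.
exact: process_term_cvg.
Qed.

Lemma L2rhoB g h : L2 g -> L2 h -> L2 (g - h).
Proof. by move=> hg hh; rewrite addrC -scaleN1r; exact: L2rho_lin. Qed.

Lemma cvg_partial_energy (x : nat -> process T R n 1) g N t :
  (forall k i, (fun l => x l k t i ord0) @ \oo --> g k t i ord0) ->
  partial_energy (x l) N t @[l --> \oo] --> partial_energy g N t.
Proof.
move=> xg; rewrite /partial_energy.
apply: cvg_big => [|k _]; first exact: add_continuous.
apply: cvgMr; rewrite innerE; under eq_fun do rewrite innerE.
apply: cvg_big => [|i _]; first exact: add_continuous.
exact: cvgM.
Qed.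

(** A fast Cauchy sequence converges almost surely in every coordinate; the
    limit is taken to be an upper limit so that it is measurable with respect
    to the past everywhere, and the norm bounds pass to it by Fatou. *)
Theorem L2rho_complete (s : nat -> process T R n 1) (C : R) :
  (forall j, L2 (s j)) ->
  (forall i j, (i <= j)%N -> pip (s i - s j) (s i - s j) <= C * 4^-1 ^+ i) ->
  exists g, L2 g /\ forall i, pip (s i - g) (s i - g) <= C * 4^-1 ^+ i.
Proof.
move=> hs hC.
have L2d i j : L2 (s i - s j) by exact: L2rhoB.
have ps j : predictable w (s j) by case: (hs j).
pose g : process T R n 1 := fun k t =>
  \matrix_(i, j) fine (limn_esup (fun l => (s l k t i j)%:E)).
have pg : predictable w g.
  move=> k i j; apply: (eq_measurable_fun (fun t : g_sigma_algebraType (past w k) =>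
      fine (limn_esup (fun l => (s l k t i j)%:E)))) => [t _|].
    by rewrite mxE.
  apply: measurableT_comp; first exact: fine_measurable.
  by apply: measurable_fun_limn_esup => l; apply/measurable_EFinP; exact: ps.
have good : {ae P, forall t, forall k i, (fun l => s l k t i ord0) @ \oo --> g k t i ord0}.
  apply: ae_foralln => k; apply: filter_forall => i.
  have : {ae P, forall t, cvgn (fun l => s l k t i ord0)}.
    apply: (@fast_ae_cvg _ _ _ P (fun l t => s l k t i ord0) (C / wt k)) => j.
      exact: predictable_random_vector.
    apply: (@le_trans _ _ (\int[P]_t (inner ((s j - s j.+1) k t) ((s j - s j.+1) k t))%:E)%E).
      have [ml _] := L2rho_square_integrable mw k (L2d j j.+1).
      apply: ge0_le_integral => //.
      - by move=> t _; rewrite lee_fin sqr_ge0.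
      - apply/measurable_EFinP; apply: measurable_funX; apply: measurable_funB;
        exact: predictable_random_vector.
      - by apply/measurable_EFinP; exact: measurable_inner.
      move=> t _; rewrite lee_fin innerE (bigD1 i) //= !mxE -expr2 lerDl.
      by apply: sumr_ge0 => i' _; rewrite -expr2 sqr_ge0.
    rewrite mean_innerE ?lee_fin; try exact: L2rho_square_integrable.
    rewrite mulrAC ler_pdivlMr ?weight_gt0 // mulrC.
    by apply: le_trans (process_term_le_ip mw k (L2d _ _)) _; exact: hC.
  apply: filterS => t ct; rewrite /g mxE.
  have cE : (s l k t i ord0)%:E @[l --> \oo] --> (limn (fun l => s l k t i ord0))%:E.
    by apply: cvg_EFin; [exact: nearW|exact: ct].
  by rewrite (cvg_limn_einf_sup cE).2; exact: ct.
have pd j : predictable w (s j - g).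
  by rewrite addrC -scaleN1r; apply: predictable_lin.
have bound j N : (\int[P]_t (partial_energy (s j - g) N t)%:E <= (C * 4^-1 ^+ j)%:E)%E.
  pose F l t := partial_energy (s j - s l) N t.
  have mF h : predictable w h -> measurable_fun setT (fun t => (partial_energy h N t)%:E).
    move=> ph; apply/measurable_EFinP; apply: measurable_sum => k.
    apply: measurable_funM => //.
    by apply: measurable_inner; exact: predictable_random_vector.
  have F0 h t : (0 <= (partial_energy h N t)%:E)%E.
    by rewrite lee_fin sumr_ge0 // => k _; rewrite mulr_ge0 ?weight_ge0 ?inner_ge0.
  have mFl l : measurable_fun setT (fun t => (F l t)%:E) by apply: mF; case: (L2d j l).
  have mlim : measurable_fun setT (fun t => limn_einf (fun l => (F l t)%:E)).
    rewrite (_ : (fun t => _) = (fun t => - limn_esup (fun l => - (F l t)%:E))%E).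
      apply: measurableT_comp => //; apply: measurable_fun_limn_esup => l.
      exact: measurableT_comp.
    apply/funext => t; rewrite -limn_einfN; congr limn_einf.
    by apply/funext => l; rewrite /comp oppeK.
  have -> : (\int[P]_t (partial_energy (s j - g) N t)%:E =
             \int[P]_t limn_einf (fun l => (F l t)%:E))%E.
    apply: ae_eq_integral => //; first exact: mF.
    apply: filterS good => t gt _.
    have cF : (F l t)%:E @[l --> \oo] --> (partial_energy (s j - g) N t)%:E.
      apply: cvg_EFin; first exact: nearW.
      have subE (h h' : process T R n 1) k i : (h - h') k t i ord0 = h k t i ord0 - h' k t i ord0.
        by rewrite !mxE.
      apply: cvg_partial_energy => k i; rewrite subE.
      under eq_fun do rewrite subE.
      by apply: cvgB; [exact: cvg_cst|exact: gt].
    by have [-> _] := cvg_limn_einf_sup cF.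
  apply: le_trans (fatou P measurableT mFl _) _; first by move=> l t _; exact: F0.
  rewrite limn_einf_lim; apply: lime_le; first exact: is_cvg_einfs.
  apply: nearW => l; apply: ge_ereal_inf.
  exists (\int[P]_t (F (maxn l j) t)%:E)%E; last first.
    apply: le_trans (partial_energy_le_ip N (L2d _ _)) _.
    by rewrite lee_fin hC // leq_maxr.
  by exists (maxn l j) => //=; rewrite leq_maxl.
have d0 := L2rho_energy_bound (pd _) (bound _).
exists g; split; last by move=> i; case: (d0 i).
rewrite (_ : g = s 0%N - (s 0%N - g)); first by apply: L2rhoB => //; case: (d0 0%N).
by rewrite opprB addrC subrK.
Qed.

End Completeness.

(** * Conditional expectations as adjoints *)

Section DensityOnSubSigmaAlgebra.
Import HBNNSimple.
Context d (T : measurableType d) (R : realType) (P : probability T R).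
Context (G : set (set T)) (sG : sigma_algebra setT G) (GT : G `<=` measurable).

Let TG := g_sigma_algebraType G.

Let measurable_GE (A : set T) : measurable (A : set TG) -> G A.
Proof. by rewrite -[X in _ -> X _](sigma_algebra_id sG). Qed.

(** The right side does not mention [q]: all densities with the same integrals
    over the sets of [G] give the same value. *)
Let integral_density_simple (q : T -> R) (phi : {nnsfun TG >-> R}) :
  measurable_fun setT q -> (forall t, 0 <= q t) ->
  (forall A, G A -> (\int[P]_(t in A) (q t)%:E = P A)%E) ->
  (\int[P]_t (q t * phi t)%:E =
   \sum_(y \in range phi) (y%:E * P (phi @^-1` [set y])))%E.
Proof.
move=> mq q0 hq; rewrite fsbig_finite //=.
set r := finmap.enum_fset _.
have GA y : G (phi @^-1` [set y]).
  by apply: measurable_GE; rewrite -[X in measurable X]setTI; exact: measurable_funP.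
have phiE t : phi t = \sum_(y <- r) y * \1_(phi @^-1` [set y]) t.
  by rewrite (fimfunE phi t) fsbig_finite.
have phi0 y t : 0 <= y * (\1_(phi @^-1` [set y]) t : R).
  by have := nnfun_muleindic_ge0 phi y t; rewrite -EFinM lee_fin.
have mI y : measurable_fun setT (\1_(phi @^-1` [set y]) : T -> R).
  by apply: measurable_indic; exact: GT.
transitivity (\int[P]_t \sum_(y <- r) (q t * (y * \1_(phi @^-1` [set y]) t))%:E)%E.
  by apply: eq_integral => t _; rewrite phiE mulr_sumr sumEFin.
rewrite ge0_integral_sum //; last 2 first.
- by move=> y; apply/measurable_EFinP; apply: measurable_funM => //; exact: measurable_funM.
- by move=> y t _; rewrite lee_fin mulr_ge0.
apply: eq_big_seq => y yr.
have y0 : 0 <= y.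
  move: yr; rewrite in_fset_set // inE => -[t _ <-]; exact: fun_ge0.
transitivity (y%:E * \int[P]_t (q t * \1_(phi @^-1` [set y]) t)%:E)%E.
  rewrite -ge0_integralZl_EFin //.
  - by apply: eq_integral => t _; rewrite -EFinM mulrCA.
  - by move=> t _; rewrite lee_fin mulr_ge0.
  - by apply/measurable_EFinP; exact: measurable_funM.
congr (_ * _)%E; rewrite -hq // [RHS]integral_mkcond.
by apply: eq_integral => t _; rewrite epatch_indic /= EFinM.
Qed.

Let integral_density_lim (q f : T -> R) (phi : nat -> {nnsfun TG >-> R}) :
  measurable_fun setT q -> (forall t, 0 <= q t) ->
  nondecreasing_seq (fun l => phi l : T -> R) ->
  (forall t, (phi l t)%:E @[l --> \oo] --> (f t)%:E) ->
  (\int[P]_t (q t * f t)%:E = limn (fun l => \int[P]_t (q t * phi l t)%:E))%E.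
Proof.
move=> mq q0 nd cv.
rewrite -monotone_convergence //; last 3 first.
- move=> l; apply/measurable_EFinP; apply: measurable_funM => //.
  apply: (measurable_wrt_sub GT); exact: (measurable_funP (phi l)).
- by move=> l t _; rewrite lee_fin mulr_ge0 //; exact: (fun_ge0 (s := phi l)).
- move=> t _ a b ab; rewrite lee_fin ler_wpM2l //; exact: (lefP _ _ (nd a b ab) t).
apply: eq_integral => t _; apply/esym/cvg_lim => //.
under eq_fun do rewrite EFinM.
by rewrite EFinM; apply: cvgeZl => //; exact: cv.
Qed.

(** The pull-out property [E[q f] = E[f]] when [E[q | G] = 1], for nonnegative
    [f] of possibly infinite integral.  The approximating simple functions are
    measurable for [G], so their level sets belong to [G]. *)
Lemma integral_conditional_density (q f : T -> R) :
  measurable_fun setT q -> (forall t, 0 <= q t) ->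
  (forall A, G A -> (\int[P]_(t in A) (q t)%:E = P A)%E) ->
  measurable_wrt G f -> (forall t, 0 <= f t) ->
  (\int[P]_t (q t * f t)%:E = \int[P]_t (f t)%:E)%E.
Proof.
move=> mq q0 hq mf f0.
have mfE : measurable_fun [set: TG] (fun t => (f t)%:E) by exact/measurable_EFinP.
pose phi := nnsfun_approx (@measurableT _ TG) mfE.
have nd := nd_nnsfun_approx measurableT mfE.
have cv (t : TG) : (phi l t)%:E @[l --> \oo] --> (f t)%:E.
  by apply: cvg_nnsfun_approx => // x _; rewrite lee_fin.
rewrite (integral_density_lim mq q0 nd cv).
transitivity (\int[P]_t (1 * f t)%:E)%E; last by under eq_integral do rewrite mul1r.
rewrite (@integral_density_lim (fun=> 1) f phi) //.
congr (limn _); apply/funext => l.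
rewrite !integral_density_simple //.
by move=> A GA; rewrite integral_cst ?mul1e //; exact: GT.
Qed.

End DensityOnSubSigmaAlgebra.

Section ConditionalExpectation.
Context d (T : measurableType d) (R : realType) (P : probability T R).
Context (G : set (set T)) (sG : sigma_algebra setT G) (GT : G `<=` measurable).

Lemma condexpP (X Y : T -> R) : is_condexp P G X Y -> is_condexp P G X (condexp P G X).
Proof. by move=> XY; apply: (@xgetPex _ (fun=> 0) [set Y | is_condexp P G X Y]); exists Y. Qed.

(** The difference [Y - Z] integrates to 0 over the set where it is positive,
    which belongs to [G]. *)
Lemma is_condexp_le (X Y Z : T -> R) : is_condexp P G X Y -> is_condexp P G X Z ->
  {ae P, forall t, Y t <= Z t}.
Proof.
move=> [_ iY mY eY] [_ iZ mZ eZ].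
pose D t := Y t - Z t; pose A := D @^-1` `]0, +oo[%classic.
have mD : measurable_wrt G D by exact: measurable_funB.
have GA : G A by apply: measurable_wrt_set => //; exact: measurable_itv.
have mA : measurable A by exact: GT.
have D0 : (\int[P]_(t in A) `|(D t)%:E| = 0)%E.
  transitivity (\int[P]_(t in A) ((Y t)%:E - (Z t)%:E))%E.
    apply: eq_integral => t; rewrite inE /A /= in_itv /= andbT => Dt.
    by rewrite ger0_norm ?ltW.
  rewrite integralB_EFin //; [|exact: integrableS iY|exact: integrableS iZ].
  rewrite eY // eZ // subee //; rewrite -eY //.
  by apply: integrable_fin_num => //; exact: integrableS iY.
have mDA : measurable_fun A (fun t => (D t)%:E).
  by apply/measurable_EFinP; apply: measurable_funTS; exact: measurable_wrt_sub GT mD.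
move/(ae_eq_integral_abs P mA mDA) : D0; apply: filterS => t /= h.
rewrite leNgt; apply/negP => ZY.
have Dt : 0 < D t by rewrite subr_gt0.
have := h; rewrite /A /= in_itv /= andbT => /(_ Dt) [D0].
by rewrite D0 ltxx in Dt.
Qed.

Lemma is_condexp_unique (X Y Z : T -> R) : is_condexp P G X Y -> is_condexp P G X Z ->
  {ae P, forall t, Y t = Z t}.
Proof.
move=> hY hZ; apply: filterS2 (is_condexp_le hY hZ) (is_condexp_le hZ hY) => t a b.
by apply/eqP; rewrite eq_le a b.
Qed.

End ConditionalExpectation.

Section ProcessSpace.
Context d (T : measurableType d) (R : realType) (P : probability T R)
  (w : nat -> T -> R) (rho : R).
Context (mw : forall k, measurable_fun setT (w k)).

(** The argument ties the predicate to a measurable noise, which makes the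
    predictable processes random vectors. *)
Definition L2rho_pred n of (forall k, measurable_fun setT (w k)) :
  {pred process T R n 1} := fun g => `[< L2rho P w rho g >].

Lemma L2rho_submod n : submod_closed (@L2rho_pred n mw).
Proof.
split=> [|c g h]; rewrite !unfold_in; first by apply/asboolP; exact: L2rho0.
by move=> /asboolP hg /asboolP hh; apply/asboolP; exact: L2rho_lin.
Qed.

HB.instance Definition _ n :=
  GRing.isSubmodClosed.Build R (process T R n 1) (@L2rho_pred n mw) (L2rho_submod n).

Record L2rho_type n :=
  L2rhoType { proc : process T R n 1; procP : proc \in @L2rho_pred n mw }.

HB.instance Definition _ n := [isSub for @proc n].
HB.instance Definition _ n := [Choice of L2rho_type n by <:].
HB.instance Definition _ n := [SubChoice_isSubLmodule of L2rho_type n by <:].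

Lemma L2rho_proc n (g : L2rho_type n) : L2rho P w rho (proc g).
Proof. by have := procP g; rewrite unfold_in => /asboolP. Qed.

Definition in_L2rho n (g : process T R n 1) (hg : L2rho P w rho g) : L2rho_type n :=
  L2rhoType (introT (asboolP _) hg).

Lemma L2rho_semi n :
  semi_inner (fun g h : L2rho_type n => process_ip P rho (proc g) (proc h)).
Proof.
split=> [c g h z|g h|g].
- by apply: (process_ip_lin mw); exact: L2rho_proc.
- exact: process_ipC.
- by apply: (process_ip_ge0 mw); exact: L2rho_proc.
Qed.

Lemma L2rho_complete_form n :
  complete_form (fun g h : L2rho_type n => process_ip P rho (proc g) (proc h)).
Proof.
move=> s [C hC].
have [g [hg lim]] := L2rho_complete mw (fun j => L2rho_proc (s j)) hC.
by exists (in_L2rho hg), C.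
Qed.

Definition L2rho_space n : semihilbert R := SemiHilbert (L2rho_semi n) (@L2rho_complete_form n).

Lemma eqv_ae_same n (g h : L2rho_space n) : g ≈ h <-> ae_same P (proc g) (proc h).
Proof.
split=> [/eqvP gh k|gh z].
  have := process_ip_null mw (L2rho_proc (g - h)) gh k.
  by apply: filterS => t /= h0 /h0 /(canRL (subrK _)); rewrite add0r.
by apply: (eq_process_ip rho mw) => //; [case: (L2rho_proc g)|case: (L2rho_proc h)|case: (L2rho_proc z)].
Qed.

End ProcessSpace.

Section Shift.
Context d (T : measurableType d) (R : realType) (P : probability T R)
  (w : nat -> T -> R) (rho : R) (n : nat).
Context (mw : forall k, measurable_fun setT (w k)).
Implicit Types g h : process T R n 1.

Notation pterm := (process_term P rho).
Notation pip := (process_ip P rho).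
Notation wt := (weight rho).
Notation L2 := (L2rho P w rho).

Lemma L2rho_dominated q (g : process T R q 1) h c : 0 <= c -> L2 g -> predictable w h ->
  (forall k, {ae P, forall t, inner (h k t) (h k t) <= c * inner (g k t) (g k t)}) ->
  L2 h /\ pip h h <= c * pip g g.
Proof.
move=> c0 hg ph hgh; apply: L2rho_energy_bound => // N.
have mE q' (u : process T R q' 1) : predictable w u ->
    measurable_fun setT (fun t => (partial_energy rho u N t)%:E).
  move=> pu; apply/measurable_EFinP; apply: measurable_sum => k.
  apply: measurable_funM => //.
  by apply: measurable_inner; exact: predictable_random_vector.
have E0 q' (u : process T R q' 1) t : (0 <= (partial_energy rho u N t)%:E)%E.
  by rewrite lee_fin sumr_ge0 // => k _; rewrite mulr_ge0 ?weight_ge0 ?inner_ge0.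
have mg := mE _ g (proj1 hg).
apply: (@le_trans _ _ (\int[P]_t (c%:E * (partial_energy rho g N t)%:E))%E).
  apply: ae_ge0_le_integral => //.
  - exact: mE.
  - by move=> t _; rewrite mule_ge0.
  - exact: measurable_funeM.
  have := ae_foralln hgh; apply: filterS => t ht _.
  rewrite -EFinM lee_fin mulr_sumr; apply: ler_sum => k _.
  by rewrite mulrCA ler_wpM2l ?weight_ge0.
rewrite ge0_integralZl_EFin //.
by rewrite EFinM lee_wpmul2l ?lee_fin //; exact: partial_energy_le_ip.
Qed.

Context (om : nat -> T -> R).
Hypothesis om_adapted : forall k, measurable_wrt (past w k.+1) (om k).
Hypothesis om_sq : forall k A, past w k A ->
  (\int[P]_(t in A) (om k t ^+ 2)%:E = P A)%E.

(** A delay by one period with the factor [e^rho om]; its adjoint is the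
    conditional mean [noise_mean]. *)
Definition noise_shift g : process T R n 1 := fun k t =>
  if k is l.+1 then (expR rho * om l t) *: g l t else 0.

Lemma predictable_noise_shift g : predictable w g -> predictable w (noise_shift g).
Proof.
move=> pg [|k] i j /=.
  by apply: eq_measurable_fun (measurable_cst (0 : R)) => t _; rewrite mxE.
apply: (eq_measurable_fun (fun t : g_sigma_algebraType (past w k.+1) =>
    expR rho * om k t * g k t i j)); first by move=> t _; rewrite mxE.
apply: measurable_funM; last exact: (measurable_wrtW (pastS (k := k)) (pg k i j)).
by apply: measurable_funM => //; exact: om_adapted.
Qed.

(** Conditionally on the past, [om k] has second moment 1. *)
Lemma integral_noise_shift g k : predictable w g ->
  (\int[P]_t (inner (noise_shift g k.+1 t) (noise_shift g k.+1 t))%:E =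
   ((expR rho) ^+ 2)%:E * \int[P]_t (inner (g k t) (g k t))%:E)%E.
Proof.
move=> pg; have mom : measurable_fun setT (om k).
  exact: (measurable_wrt_sub (past_measurable mw) (@om_adapted k)).
have mg : measurable_wrt (past w k) (fun t => inner (g k t) (g k t)).
  have := pg k => pgk; rewrite /measurable_wrt; under eq_fun do rewrite innerE.
  by apply: measurable_sum => i; apply: measurable_funM; exact: pgk.
have mg' := measurable_wrt_sub (past_measurable mw) mg.
rewrite -(integral_conditional_density (sigma_algebra_past w k) (past_measurable mw)
   (measurable_funX 2 mom) _ (om_sq (k := k)) mg) => [|t|t]; last 2 first.
- exact: sqr_ge0.
- exact: inner_ge0.
rewrite -ge0_integralZl_EFin ?sqr_ge0 //.
- apply: eq_integral => t _; rewrite -EFinM /=.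
  by rewrite !(siE (inner_semi R n)); congr EFin; ring.
- by move=> t _; rewrite lee_fin mulr_ge0 ?sqr_ge0 ?inner_ge0.
- by apply/measurable_EFinP; apply: measurable_funM => //; exact: measurable_funX.
Qed.

Lemma L2rho_noise_shift g : L2 g ->
  L2 (noise_shift g) /\
  pip (noise_shift g) (noise_shift g) <= expR rho * pip g g.
Proof.
move=> hg; have [pg _] := hg; have pJ := predictable_noise_shift pg.
apply: L2rho_energy_bound => // N.
apply: (@le_trans _ _ (\int[P]_t (partial_energy rho (noise_shift g) N.+1 t)%:E)%E).
  rewrite !(integral_partial_energy P rho mw) // big_nat_recr //= leeDl // mule_ge0 ?lee_fin ?weight_ge0 //.
  by apply: integral_ge0 => t _; rewrite lee_fin inner_ge0.
rewrite (integral_partial_energy P rho mw) // big_nat_recl //.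
rewrite [X in (_ * X + _)%E](_ : _ = 0%E); last first.
  by under eq_integral do rewrite (si0l (inner_semi R n)); rewrite integral0.
rewrite mule0 add0e.
under eq_bigr do rewrite integral_noise_shift // muleA -EFinM expr2 mulrA
  (mulrC (wt _)) weightS mulrC EFinM -muleA.
have i0 k : (0 <= (wt k)%:E * \int[P]_t (inner (g k t) (g k t))%:E)%E.
  by rewrite mule_ge0 ?lee_fin ?weight_ge0 // integral_ge0 // => t _; rewrite lee_fin inner_ge0.
rewrite -ge0_sume_distrr // EFinM lee_wpmul2l ?lee_fin ?expR_ge0 //.
by rewrite -(integral_partial_energy P rho mw) //; exact: partial_energy_le_ip.
Qed.

Lemma noise_shift_linear c g h :
  noise_shift (c *: g + h) = c *: noise_shift g + noise_shift h.
Proof.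
apply/funext => -[|k]; apply/funext => t.
  by rewrite -[RHS]/(c *: 0 + 0) scaler0 addr0.
rewrite -[RHS]/(c *: ((expR rho * om k t) *: g k t) + (expR rho * om k t) *: h k t).
by rewrite -[LHS]/((expR rho * om k t) *: (c *: g k t + h k t)) scalerDr !scalerA mulrC.
Qed.

(** Pairing with these vectors integrates one coordinate at one time over the
    event [A]. *)
Definition pulse k (A : set T) i : process T R n 1 := fun l t =>
  if l == k then \1_A t *: delta_mx i ord0 else 0.

Lemma inner_delta (u : 'cV[R]_n) i (c : R) : inner u (c *: delta_mx i ord0) = c * u i ord0.
Proof.
rewrite (siZr (inner_semi R n)) innerE (bigD1 i) //= mxE !eqxx mulr1 big1 ?addr0 //.
by move=> j ji; rewrite mxE (negbTE ji) mulr0.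
Qed.

Lemma process_ip_single g h k : (forall l, l != k -> h l = 0) ->
  pip g h = pterm g h k.
Proof.
move=> h0; have t0 l : l != k -> pterm g h l = 0.
  move=> lk; rewrite /process_term h0 // /mean_inner.
  under eq_Rintegral do rewrite (si0r (inner_semi R n)).
  by rewrite Rintegral_cst // mul0r mulr0.
apply/cvg_lim => //; apply: cvg_near_cst; exists k.+1 => // N /= kN.
rewrite /series /= (@big_cat_nat _ _ _ k.+1) //= big_nat_recr //=.
rewrite big_nat_cond big1 ?add0r => [|l /andP[/andP[_ lk] _]]; last first.
  by rewrite t0 // ltn_eqF.
rewrite big_nat_cond big1 ?addr0 // => l /andP[/andP[kl _] _].
by rewrite t0 // gtn_eqF.
Qed.

Lemma L2rho_pulse k A i : past w k A -> L2 (pulse k A i).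
Proof.
move=> kA.
have mA : measurable A by exact: (past_measurable mw kA).
have pp : predictable w (pulse k A i).
  move=> l i' j; rewrite /pulse; have [->|lk] := eqVneq l k; last first.
    by apply: eq_measurable_fun (measurable_cst (0 : R)) => t _; rewrite mxE.
  apply: (eq_measurable_fun (fun t : g_sigma_algebraType (past w k) =>
      \1_A t * (delta_mx i ord0 : 'cV[R]_n) i' j)); first by move=> t _; rewrite !mxE.
  by apply: measurable_funM => //; exact: measurable_wrt_indic.
have nrm t : inner (\1_A t *: delta_mx i ord0 : 'cV[R]_n) (\1_A t *: delta_mx i ord0) <= 1.
  rewrite inner_delta !mxE !eqxx mulr1 indicE.
  by case: (t \in A); rewrite ?mulr1 ?mulr0.
suff : L2 (pulse k A i) /\ pip (pulse k A i) (pulse k A i) <= wt k by case.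
apply: L2rho_energy_bound => // N; rewrite (integral_partial_energy P rho mw) //.
apply: (@le_trans _ _ (\sum_(0 <= l < N) (if l == k then wt k else 0)%:E)%E).
  apply: lee_sum => l _; rewrite /pulse; have [->|lk] := eqVneq l k; last first.
    under eq_integral do rewrite (si0l (inner_semi R n)).
    by rewrite integral0 mule0.
  rewrite -[leRHS]mule1 lee_wpmul2l ?lee_fin ?weight_ge0 //.
  rewrite -(@probability_setT _ _ _ P) -[leRHS]mul1e -(integral_cst P measurableT).
  apply: ge0_le_integral => //.
  - by move=> t _; rewrite lee_fin inner_ge0.
  - have := predictable_random_vector mw k pp; rewrite /pulse eqxx => rv.
    by apply/measurable_EFinP; exact: measurable_inner.
  - by move=> t _; rewrite lee_fin.
rewrite sumEFin lee_fin.
have [kN|Nk] := ltnP k N.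
  rewrite big_mkord (bigD1 (Ordinal kN)) //= eqxx big1 ?addr0 // => l.
  by rewrite -val_eqE /= => /negbTE ->.
rewrite big_nat_cond big1 ?weight_ge0 // => l /andP[/andP[_ lN] _].
by rewrite ltn_eqF // (leq_trans lN).
Qed.

End Shift.

Section NoiseMean.
Context d (T : measurableType d) (R : realType) (P : probability T R)
  (w : nat -> T -> R) (rho : R) (n : nat).
Context (mw : forall k, measurable_fun setT (w k)).
Context (om : nat -> T -> R).
Hypothesis om_adapted : forall k, measurable_wrt (past w k.+1) (om k).
Hypothesis om_sq : forall k A, past w k A ->
  (\int[P]_(t in A) (om k t ^+ 2)%:E = P A)%E.

Notation pterm := (process_term P rho).
Notation pip := (process_ip P rho).
Notation wt := (weight rho).
Notation L2 := (L2rho P w rho).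
Notation H := (L2rho_space P rho mw).

Definition noise_mean (y : process T R n 1) : process T R n 1 :=
  fun k => condexp_vec P (past w k) (fun t => om k t *: y k.+1 t).

Definition shift_op (g : H n) : H n :=
  in_L2rho mw (proj1 (L2rho_noise_shift mw om_adapted om_sq (L2rho_proc g))).

Lemma shift_op_linear c g h : shift_op (c *: g + h) = c *: shift_op g + shift_op h.
Proof. by apply: val_inj; exact: noise_shift_linear. Qed.

Lemma shift_op_bounded : bounded_by (expR rho) shift_op.
Proof. by move=> g; exact: (proj2 (L2rho_noise_shift mw om_adapted om_sq (L2rho_proc g))). Qed.

(** The defining property of a conditional expectation is the adjunction tested
    on pulses; in particular conditional expectations exist. *)
Lemma adjoint_is_condexp (f : H n -> H n) (y : H n) k i :
  adjoint f shift_op ->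
  is_condexp P (past w k) (fun t => (om k t *: proc y k.+1 t) i ord0)
    (fun t => proc (f y) k t i ord0).
Proof.
move=> fE; have hg := L2rho_proc (f y); have hy := L2rho_proc y.
have pG := past_measurable (k := k) mw.
pose ph A (kA : past w k A) : H n := in_L2rho mw (L2rho_pulse P rho mw i kA).
have sJ A kA : square_integrable P (proc (shift_op (ph A kA)) k.+1).
  exact: (L2rho_square_integrable mw _ (L2rho_proc _)).
have sph A kA : square_integrable P (proc (ph A kA) k).
  exact: (L2rho_square_integrable mw _ (L2rho_proc _)).
have sg := L2rho_square_integrable mw k hg.
have sy := L2rho_square_integrable mw k.+1 hy.
have inJ A kA t : inner (proc y k.+1 t) (proc (shift_op (ph A kA)) k.+1 t) =
    expR rho * (\1_A t * (om k t *: proc y k.+1 t) i ord0).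
  rewrite /= /noise_shift /pulse eqxx scalerA inner_delta mxE; ring.
have inph A kA t : inner (proc (f y) k t) (proc (ph A kA) k t) =
    \1_A t * proc (f y) k t i ord0.
  by rewrite /= /pulse eqxx inner_delta.
have kT : past w k setT.
  have [s0 sC _] := sigma_algebra_past w k; have := sC _ s0; by rewrite setD0.
have iX : P.-integrable setT (fun t => ((om k t *: proc y k.+1 t) i ord0)%:E).
  have := integrableZl measurableT (expR (- rho)) (integrable_inner sy (sJ setT kT)).
  apply: eq_integrable => // t _; rewrite inJ -EFinM; congr EFin.
  by rewrite indicT mul1r mulrA -expRD addNr expR0 mul1r.
have iY : P.-integrable setT (fun t => (proc (f y) k t i ord0)%:E).
  have := integrable_inner sg (sph setT kT).
  by apply: eq_integrable => // t _; rewrite inph indicT mul1r.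
split=> //; first by case: hg.
move=> A kA; have mA : measurable A by exact: pG.
have e := fE y (ph A kA).
have e1 : pterm (proc (f y)) (proc (ph A kA)) k =
    pterm (proc y) (proc (shift_op (ph A kA))) k.+1.
  rewrite -(process_ip_single P rho (proc (f y)) (k := k)) => [|l lk]; last first.
    by apply/funext => t; rewrite /= /pulse (negbTE lk).
  rewrite -(process_ip_single P rho (proc y) (k := k.+1)) => [|[|l] lk]; first exact: e.
    by apply/funext.
  by apply/funext => t; rewrite /= /noise_shift /pulse -eqSS (negbTE lk) scaler0.
have patchE (X : T -> R) : (\int[P]_(t in A) (X t)%:E = \int[P]_t (\1_A t * X t)%:E)%E.
  rewrite integral_mkcond; apply: eq_integral => t _.
  by rewrite epatch_indic /= -EFinM mulrC.
rewrite !patchE.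
have -> : (\int[P]_t (\1_A t * proc (f y) k t i ord0)%:E =
    (mean_inner P (proc (f y) k) (proc (ph A kA) k))%:E)%E.
  by rewrite -mean_innerE //; apply: eq_integral => t _; rewrite inph.
have -> : (\int[P]_t (\1_A t * (om k t *: proc y k.+1 t) i ord0)%:E =
    (expR (- rho) * mean_inner P (proc y k.+1) (proc (shift_op (ph A kA)) k.+1))%:E)%E.
  rewrite EFinM -mean_innerE // -integralZl //; last exact: integrable_inner.
  apply: eq_integral => t _; rewrite inJ -EFinM; congr EFin.
  by rewrite mulrA -expRD addNr expR0 mul1r.
congr EFin; move: e1; rewrite /process_term -weightS => e1.
apply: (mulfI (lt0r_neq0 (expR_gt0 rho))); apply: (mulfI (lt0r_neq0 (weight_gt0 rho k.+1))).
rewrite mulrA (mulrC (wt _)) e1 [in RHS](mulrA (expR rho)) -expRD subrr expR0.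
by rewrite mul1r.
Qed.

(** The chosen versions of the conditional expectations agree almost surely with
    the adjoint given by the representation theorem, so they are an adjoint as
    well. *)
Lemma noise_mean_adjoint : exists f : H n -> H n, adjoint f shift_op /\
  forall y, proc (f y) = noise_mean (proc y).
Proof.
have [f0 hf0] := adjoint_exists shift_op_linear shift_op_bounded.
have ce y k i := adjoint_is_condexp y k i hf0.
have same (y : H n) : ae_same P (noise_mean (proc y)) (proc (f0 y)).
  move=> k.
  have : {ae P, forall t, forall i,
      condexp P (past w k) (fun t => (om k t *: proc y k.+1 t) i ord0) t
      = proc (f0 y) k t i ord0}.
    apply: filter_forall => i.
    have h := is_condexp_unique (sigma_algebra_past w k) (past_measurable mw (k := k))
      (condexpP (ce y k i)) (ce y k i).
    exact: h.
  by apply: filterS => t ht _; apply/matrixP => i j; rewrite ord1 mxE ht.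
have pN (y : H n) : predictable w (noise_mean (proc y)).
  move=> k i j; have [_ _ m _] := condexpP (ce y k i).
  by apply: eq_measurable_fun m => t _; rewrite mxE.
have L2N (y : H n) : L2 (noise_mean (proc y)).
  suff dom k : {ae P, forall t, inner (noise_mean (proc y) k t) (noise_mean (proc y) k t)
      <= 1 * inner (proc (f0 y) k t) (proc (f0 y) k t)}.
    exact: (proj1 (L2rho_dominated mw ler01 (L2rho_proc (f0 y)) (pN y) dom)).
  by have := same y k; apply: filterS => t /(_ I) ->; rewrite mul1r.
exists (fun y => in_L2rho mw (L2N y)); split=> // y z.
rewrite -hf0; suff e : (in_L2rho mw (L2N y) : H n) ≈ f0 y by exact: e.
by apply/eqv_ae_same; exact: same.
Qed.

End NoiseMean.

(** * Multiplication by bounded coefficients *)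

Section Multipliers.
Context d (T : measurableType d) (R : realType) (P : probability T R)
  (w : nat -> T -> R) (rho : R).
Context (mw : forall k, measurable_fun setT (w k)).
Notation H := (L2rho_space P rho mw).

Definition multiplier p q (X : process T R p q) c : Prop :=
  predictable w X /\ forall k, {ae P, forall t, forall u,
    inner (X k t *m u) (X k t *m u) <= c * inner u u}.

(** By Cauchy-Schwarz in [|X^T u|^2 = <u, X (X^T u)>]. *)
Lemma multiplier_tr p q (X : process T R p q) c : 0 <= c ->
  multiplier X c -> multiplier (fun k t => (X k t)^T) c.
Proof.
move=> c0 [pX hX]; split=> [k i j|k].
  by apply: eq_measurable_fun (pX k j i) => t _; rewrite mxE.
apply: filterS (hX k) => t ht u; set v := (X k t)^T *m u.
have := inner_ge0 v; rewrite le_eqVlt => /orP[/eqP v0|v0].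
  by rewrite -v0 mulr_ge0 // inner_ge0.
have h : inner v v ^+ 2 <= inner u u * (c * inner v v).
  have e : inner v v = inner u (X k t *m v) by rewrite {1}/v inner_mulmx trmxK.
  rewrite {1}e; apply: le_trans (si_cauchy_schwarz (inner_semi R p) _ _) _.
  by rewrite ler_wpM2l ?inner_ge0.
by rewrite -(ler_pM2r v0) -expr2 (le_trans h) // mulrA (mulrC c).
Qed.

Lemma predictable_mulmx p q (X : process T R p q) (g : process T R q 1) :
  predictable w X -> predictable w g -> predictable w (fun k t => X k t *m g k t).
Proof.
move=> pX pg k i j.
apply: (eq_measurable_fun (fun t : g_sigma_algebraType (past w k) =>
  \sum_l X k t i l * g k t l j)) => [t _|]; first by rewrite mxE.
by apply: measurable_sum => l; apply: measurable_funM; [exact: pX|exact: pg].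
Qed.

Section Op.
Context p q (X : process T R p q) (c : R) (c0 : 0 <= c) (hX : multiplier X c).

Lemma L2rho_mulmx (g : process T R q 1) : L2rho P w rho g ->
  L2rho P w rho (fun k t => X k t *m g k t) /\
  process_ip P rho (fun k t => X k t *m g k t) (fun k t => X k t *m g k t)
    <= c * process_ip P rho g g.
Proof.
move=> hg; have [pg _] := hg; have [pX bX] := hX.
apply: (L2rho_dominated mw c0 hg); first exact: predictable_mulmx.
by move=> k; apply: filterS (bX k) => t ht; exact: ht.
Qed.

Definition mul_op (g : H q) : H p := in_L2rho mw (proj1 (L2rho_mulmx (L2rho_proc g))).

Lemma mul_op_bounded : bounded_by c mul_op.
Proof. by move=> g; exact: (proj2 (L2rho_mulmx (L2rho_proc g))). Qed.

End Op.

Lemma mul_op_adjoint p q (X : process T R p q) c (c0 : 0 <= c) (hX : multiplier X c)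
  (X' : process T R q p) (hX' : multiplier X' c) :
  (forall k t, X' k t = (X k t)^T) -> adjoint (mul_op c0 hX) (mul_op c0 hX').
Proof.
move=> XX' u z; rewrite /= /process_ip; congr (limn (series _)).
apply/funext => k; rewrite /process_term; congr (_ * _).
by apply: eq_Rintegral => t _; rewrite inner_mulmx XX'.
Qed.

End Multipliers.

(** The left side bounds the squared norm of the operator
    [x |-> J_1 (A^T x) + J_w (B^T x)]. *)
Lemma discount_contraction (R : realType) (rho : R) (sA sB : \bar R) :
  (0 <= sA)%E -> (0 <= sB)%E -> sA \is a fin_num -> sB \is a fin_num ->
  (rho%:E < - lne (6%:E * (sA + sB) ^+ 2))%E ->
  expR rho * (2 * fine sA ^+ 2 + 2 * fine sB ^+ 2) <= 3^-1.
Proof.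
case: sA sB => [a||] [b||] //; rewrite !lee_fin => a0 b0 _ _.
rewrite -EFinD -EFin_expe -EFinM /fine => lt.
have key : expR rho * (6 * (a + b) ^+ 2) <= 1.
  move: lt; set s := 6 * _; have s0 : 0 <= s by rewrite mulr_ge0 // sqr_ge0.
  (* the logarithm is infinite when both coefficients vanish *)
  move: s0; rewrite le_eqVlt => /orP[/eqP <-|s0]; first by rewrite mulr0.
  rewrite lne_EFin // -EFinN lte_fin => lt.
  rewrite -[leRHS](mulVf (lt0r_neq0 s0)) ler_wpM2r // ?ltW //.
  by rewrite -[s^-1]lnK ?posrE ?invr_gt0 // ltr_expR lnV.
have le : expR rho * (2 * a ^+ 2 + 2 * b ^+ 2) <= expR rho * (2 * (a + b) ^+ 2).
  by rewrite ler_wpM2l ?expR_ge0 //; have := mulr_ge0 a0 b0; rewrite sqrrD; lra.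
lra.
Qed.

Section Coefficients.
Context d (T : measurableType d) (R : realType) (P : probability T R)
  (w : nat -> T -> R).

(** Cauchy-Schwarz in each row. *)
Lemma inner_mulmx_frob p q (X : 'M[R]_(p, q)) (u : 'cV[R]_q) :
  inner (X *m u) (X *m u) <= frob_norm X ^+ 2 * inner u u.
Proof.
have rowE i : (X *m u) i ord0 = inner (row i X)^T u.
  by rewrite innerE mxE; apply: eq_bigr => j _; rewrite !mxE.
have trE : \tr (X *m X^T) = \sum_i inner (row i X)^T (row i X)^T.
  rewrite /mxtrace; apply: eq_bigr => i _; rewrite innerE mxE.
  by apply: eq_bigr => j _; rewrite !mxE.
have tr0 : 0 <= \tr (X *m X^T) by rewrite trE sumr_ge0 // => i _; exact: inner_ge0.
rewrite /frob_norm sqr_sqrtr // trE innerE mulr_suml; apply: ler_sum => i _.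
by rewrite rowE -expr2; exact: si_cauchy_schwarz (inner_semi R q) _ _.
Qed.

Lemma sup_norm_ge0 p q (X : process T R p q) : (0 <= sup_norm P X)%E.
Proof.
apply: le_trans (ereal_sup_ubound (ex_intro2 _ _ 0%N I erefl)).
apply: ess_sup_ger => [|t]; last by rewrite lee_fin sqrtr_ge0.
by apply: (@lt_le_trans _ _ 1%E) => //; rewrite -(probability_setT P).
Qed.

Lemma sup_norm_fin_num p q (X : process T R p q) : Linfty P w X ->
  sup_norm P X \is a fin_num.
Proof. by move=> [_ fX]; rewrite ge0_fin_numE // sup_norm_ge0. Qed.

Lemma Linfty_multiplier p q (X : process T R p q) : Linfty P w X ->
  multiplier P w X (fine (sup_norm P X) ^+ 2).
Proof.
move=> hX; have fX := sup_norm_fin_num hX; have [pX _] := hX; split=> // k.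
have := ess_sup_ge P (fun t => (frob_norm (X k t))%:E); apply: filterS => t ht u.
apply: le_trans (inner_mulmx_frob _ _) _; rewrite ler_wpM2r ?inner_ge0 //.
rewrite lerXn2r ?nnegrE ?sqrtr_ge0 ?fine_ge0 ?sup_norm_ge0 //.
rewrite -lee_fin fineK //; apply: le_trans ht _.
by apply: ereal_sup_ubound; exists k.
Qed.

Lemma constant_multiplier p q (X : nat -> 'M[R]_(p, q)) c :
  (forall k, frob_norm (X k) ^+ 2 <= c) -> multiplier P w (fun k _ => X k) c.
Proof.
move=> hX; split=> [k i j|k]; first exact: measurable_cst.
apply: aeW => t u; apply: le_trans (inner_mulmx_frob _ _) _.
by rewrite ler_wpM2r ?inner_ge0.
Qed.

Lemma measurable_invr : measurable_fun [set: R] (fun x : R => x^-1).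
Proof.
(* this formula for the inverse also holds at 0 *)
apply: (eq_measurable_fun (fun x : R => x * expR (- ln (x ^+ 2)))) => [x _|].
  have [->|x0] := eqVneq x 0; first by rewrite mul0r invr0.
  rewrite expRN lnK ?posrE ?exprn_even_gt0 //; by field.
apply: measurable_funM => //; apply: measurableT_comp => //; apply: measurable_funN.
by apply: measurableT_comp => //; exact: measurable_funX.
Qed.

Lemma nonneg_def_unit q (X : 'M[R]_q) delta : 0 < delta ->
  nonneg_def (X - delta%:M) -> X \in unitmx.
Proof.
move=> d0 hX; rewrite -row_free_unit; apply: inj_row_free => v vX.
have := hX v^T; rewrite mulmxBl mul_scalar_mx (siBl (inner_semi R q)).
rewrite (siZl (inner_semi R q)) inner_mulmx -trmx_mul vX trmx0.
rewrite (si0r (inner_semi R q)) sub0r oppr_ge0 pmulr_rle0 // => /inner_eq0 v0.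
by rewrite -[v]trmxK v0 trmx0.
Qed.

Context (m : nat) (S : process T R m m) (delta : R) (delta0 : 0 < delta)
  (hS : forall k t, nonneg_def (S k t - delta%:M)).

(** Measurability is Cramer's rule.  For [v = S^-1 u], positivity gives
    [delta |v|^2 <= <S v, v> = <u, v>], whence [delta |v| <= |u|]. *)
Lemma invmx_multiplier : predictable w S ->
  multiplier P w (fun k t => invmx (S k t)) (delta ^- 2).
Proof.
move=> pS; have US k t := nonneg_def_unit delta0 (hS k t).
split=> [k i j|k].
  have mdet q (A : T -> 'M[R]_q) : (forall i j, measurable_wrt (past w k) (fun t => A t i j)) ->
      measurable_wrt (past w k) (fun t => \det (A t)).
    move=> mA; rewrite /measurable_wrt; apply: measurable_sum => s.
    apply: measurable_funM; first exact: measurable_cst.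
    by apply: measurable_prod => l _; exact: mA.
  apply: (eq_measurable_fun (fun t : g_sigma_algebraType (past w k) =>
      (\det (S k t))^-1 * ((-1) ^+ (j + i) * \det (row' j (col' i (S k t)))))) => [t _|].
    by rewrite /invmx US !mxE.
  apply: measurable_funM.
    by apply: (measurableT_comp measurable_invr); apply: mdet; exact: pS.
  apply: measurable_funM; first exact: measurable_cst.
  apply: mdet => i' j'; apply: eq_measurable_fun (pS k (lift j i') (lift i j')) => t _.
  by rewrite !mxE.
apply: aeW => t u; set v := _ *m u.
have uE : u = S k t *m v by rewrite mulKVmx.
have := hS k t v; rewrite mulmxBl mul_scalar_mx -uE.
rewrite (siBl (inner_semi R m)) (siZl (inner_semi R m)) subr_ge0 => le_uv.
have v0 := inner_ge0 v.
have le2 : (delta * inner v v) ^+ 2 <= inner u u * inner v v.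
  apply: le_trans (si_cauchy_schwarz (inner_semi R m) u v).
  by rewrite lerXn2r ?nnegrE ?mulr_ge0 // ?(le_trans _ le_uv) ?mulr_ge0 // ltW.
rewrite mulrC ler_pdivlMr ?exprn_gt0 // mulrC.
move: v0; rewrite le_eqVlt => /orP[/eqP v0|v0]; first by rewrite -v0 mulr0 inner_ge0.
by rewrite -(ler_pM2r v0) (le_trans _ le2) // exprMn [in leRHS]expr2 mulrA.
Qed.

End Coefficients.

(** * The backward problem *)

Section BackwardLQ.
Context d (T : measurableType d) (R : realType) (n m : nat)
  (P : probability T R) (w : nat -> T -> R) (rho : R) (D : blq_data T R n m).
Hypotheses (hw : mart_diff_noise P w) (hD : blq_admissible P w rho D)
  (hM : pos_def (wtM D))
  (hQL : forall k t, nonneg_def (wtQ D k t) /\ nonneg_def (wtL D k t))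
  (delta : R) (delta0 : 0 < delta)
  (hR : forall k t, nonneg_def (wtR D k t - delta%:M))
  (hrho : (rho%:E < - lne (6%:E *
     (sup_norm P (matA D) + sup_norm P (matB D)) ^+ 2))%E).

Lemma noise_measurable k : measurable_fun setT (w k).
Proof. by case: (hw k). Qed.

Notation H := (L2rho_space P rho noise_measurable).
Notation L2 := (L2rho P w rho).

Lemma unit_sq k A : past w k A -> (\int[P]_(t in A) ((1 : R) ^+ 2)%:E = P A)%E.
Proof.
move=> kA; rewrite expr1n integral_cst ?mul1e //.
exact: past_measurable noise_measurable _ kA.
Qed.

Lemma noise_sq k A : past w k A -> (\int[P]_(t in A) (w k t ^+ 2)%:E = P A)%E.
Proof.
move=> kA; have [_ _ [_ _ _ e]] := hw k; rewrite -e //.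
rewrite integral_cst ?mul1e //; exact: past_measurable noise_measurable _ kA.
Qed.

Lemma unit_adapted k : measurable_wrt (past w k.+1) (fun _ : T => 1 : R).
Proof. exact: measurable_cst. Qed.

Let J1 := @shift_op _ _ _ P w rho n noise_measurable (fun _ _ => 1) unit_adapted unit_sq.
Let Jw := @shift_op _ _ _ P w rho n noise_measurable w (@past_noise _ _ _ w) noise_sq.

Lemma mean_operators : exists E1 Ew : H n -> H n,
  [/\ adjoint E1 J1, adjoint Ew Jw,
      forall y, proc (E1 y) = yprime P w (proc y)
    & forall y, proc (Ew y) = zprime P w (proc y)].
Proof.
have [E1 [a1 e1]] := noise_mean_adjoint rho n noise_measurable unit_adapted unit_sq.
have [Ew [aw ew]] := noise_mean_adjoint rho n noise_measurable (@past_noise _ _ _ w) noise_sq.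
exists E1, Ew; split; [exact: a1|exact: aw| |exact: ew] => y; rewrite e1; apply/funext => k.
by rewrite /noise_mean /yprime; congr condexp_vec; apply/funext => t; rewrite scale1r.
Qed.

Let a := fine (sup_norm P (matA D)).
Let b := fine (sup_norm P (matB D)).

Lemma rho_bound : expR rho * (2 * (a ^+ 2) + 2 * (b ^+ 2)) <= 3^-1.
Proof.
have [[hA hB _ _] _] := hD.
exact: (discount_contraction (sup_norm_ge0 P _) (sup_norm_ge0 P _)
  (sup_norm_fin_num hA) (sup_norm_fin_num hB) hrho).
Qed.


Section Operators.
Context (E1 Ew : H n -> H n).
Hypotheses (E1J1 : adjoint E1 J1) (EwJw : adjoint Ew Jw)
  (E1E : forall y, proc (E1 y) = yprime P w (proc y))
  (EwE : forall y, proc (Ew y) = zprime P w (proc y)).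

Let mA : multiplier P w (matA D) (a ^+ 2).
Proof. by case: hD => -[hA _ _ _] _; exact: Linfty_multiplier. Qed.
Let mB : multiplier P w (matB D) (b ^+ 2).
Proof. by case: hD => -[_ hB _ _] _; exact: Linfty_multiplier. Qed.
Let c := fine (sup_norm P (matC D)).
Let mC : multiplier P w (matC D) (c ^+ 2).
Proof. by case: hD => -[_ _ hC _] _; exact: Linfty_multiplier. Qed.
Let cQ := fine (sup_norm P (wtQ D)).
Let mQ : multiplier P w (wtQ D) (cQ ^+ 2).
Proof. by case: hD => _ [_ [hQ _] _ _]; exact: Linfty_multiplier. Qed.
Let cL := fine (sup_norm P (wtL D)).
Let mL : multiplier P w (wtL D) (cL ^+ 2).
Proof. by case: hD => _ [_ _ [hL _] _]; exact: Linfty_multiplier. Qed.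
Let cR := fine (sup_norm P (wtR D)).
Let mR : multiplier P w (wtR D) (cR ^+ 2).
Proof. by case: hD => _ [_ _ _ [hR' _]]; exact: Linfty_multiplier. Qed.
Let cM := frob_norm (wtM D).

(** The initial cost as a term of the discounted sum, whose weight at time 0
    is 1. *)
Let initial_weight : process T R n n := fun k _ => if k == 0%N then wtM D else 0.
Let mM : multiplier P w initial_weight (cM ^+ 2).
Proof.
apply: (@constant_multiplier _ _ _ _ _ _ _ (fun k => if k == 0%N then wtM D else 0)) => k.
case: eqP => // _; rewrite /frob_norm mul0mx mxtrace0 sqrtr0 expr0n /=.
exact: sqr_ge0.
Qed.

Let op p q (X : process T R p q) cX (hX : multiplier P w X (cX ^+ 2)) : H q -> H p :=
  mul_op (sqr_ge0 cX) hX.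

Let op_tr p q (X : process T R p q) cX (hX : multiplier P w X (cX ^+ 2)) : H p -> H q :=
  mul_op (sqr_ge0 cX) (multiplier_tr (sqr_ge0 cX) hX).

Let op_adjoint p q (X : process T R p q) cX (hX : multiplier P w X (cX ^+ 2)) :
  adjoint (op hX) (op_tr hX).
Proof. exact: mul_op_adjoint. Qed.

Let op_selfadjoint q (X : process T R q q) cX (hX : multiplier P w X (cX ^+ 2)) :
  (forall k t, X k t \is symmetricmx) -> adjoint (op hX) (op hX).
Proof.
move=> sX; apply: mul_op_adjoint => k t.
by have /is_hermitianmxP := sX k t; rewrite expr0 scale1r map_mx_id.
Qed.

Let op_bounded p q (X : process T R p q) cX (hX : multiplier P w X (cX ^+ 2)) :
  bounded_by (cX ^+ 2) (op hX).
Proof. exact: mul_op_bounded. Qed.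

Let op_tr_bounded p q (X : process T R p q) cX (hX : multiplier P w X (cX ^+ 2)) :
  bounded_by (cX ^+ 2) (op_tr hX).
Proof. exact: mul_op_bounded. Qed.

Let K := (op mA \o E1) \+ (op mB \o Ew).
Let K' := (J1 \o op_tr mA) \+ (Jw \o op_tr mB).

Let KK' : adjoint K K'.
Proof. by apply: adjoint_add; apply: adjoint_comp. Qed.

Let J1_bounded : bounded_by (expR rho) J1. Proof. exact: shift_op_bounded. Qed.
Let Jw_bounded : bounded_by (expR rho) Jw. Proof. exact: shift_op_bounded. Qed.

Let K'_bounded : bounded_by 3^-1 K'.
Proof.
have := rho_bound; rewrite mulrDr => h.
apply: (@bounded_by_le _ _ _ (2 * (expR rho * a ^+ 2) + 2 * (expR rho * b ^+ 2))).
  by lra.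
exact: (bounded_add (bounded_comp (expR_ge0 rho) (op_tr_bounded mA) J1_bounded)
  (bounded_comp (expR_ge0 rho) (op_tr_bounded mB) Jw_bounded)).
Qed.

Let N := (J1 \o (op mQ \o E1)) \+ (Jw \o (op mL \o Ew)) \+ op mM.

Let NN : adjoint N N.
Proof.
have [_ [sM [_ sQ] [_ sL] _]] := hD.
have sM' k t : initial_weight k t \is symmetricmx.
  rewrite /initial_weight; case: eqP => // _; apply/is_hermitianmxP.
  by rewrite expr0 scale1r map_mx_id // trmx0.
apply: adjoint_add; last exact: op_selfadjoint.
have A1 := adjoint_comp (adjoint_comp E1J1 (op_selfadjoint mQ sQ)) (adjointC E1J1).
have Aw := adjoint_comp (adjoint_comp EwJw (op_selfadjoint mL sL)) (adjointC EwJw).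
exact: adjoint_add A1 Aw.
Qed.

Let ip_pointwise_ge0 p (g h : H p) :
  (forall k t, 0 <= inner (proc g k t) (proc h k t)) -> 0 <= ip g h.
Proof.
move=> gh0; apply: limr_ge; first exact: (process_term_cvg noise_measurable (L2rho_proc g) (L2rho_proc h)).
apply: nearW => j; apply: sumr_ge0 => k _.
by rewrite mulr_ge0 ?weight_ge0 // Rintegral_ge0.
Qed.

Let ip_NE y z : ip (N y) z = ip (op mQ (E1 y)) (E1 z) + ip (op mL (Ew y)) (Ew z) + ip (op mM y) z.
Proof.
rewrite -[N y]/(J1 (op mQ (E1 y)) + Jw (op mL (Ew y)) + op mM y).
by rewrite !(siDl (ip_semi (H n))) (adjointC E1J1) (adjointC EwJw).
Qed.

Let initial_weight_ge0 k t : nonneg_def (initial_weight k t).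
Proof.
move=> u; rewrite /initial_weight; case: eqP => [_|_]; last first.
  by rewrite mul0mx (si0l (inner_semi R n)).
have [->|u0] := eqVneq u 0; first by rewrite mulmx0 (si0l (inner_semi R n)).
by apply: ltW; exact: hM.
Qed.

Let gain_weight_ge0 k t : nonneg_def (wtR D k t).
Proof.
move=> u; have := hR k t u; rewrite mulmxBl mul_scalar_mx (siBl (inner_semi R m)).
rewrite (siZl (inner_semi R m)) subr_ge0; apply: le_trans.
by rewrite mulr_ge0 ?inner_ge0 // ltW.
Qed.

Let N_ge0 y : 0 <= ip (N y) y.
Proof.
rewrite ip_NE !addr_ge0 //; apply: ip_pointwise_ge0 => k t.
- exact: (proj1 (hQL k t)).
- exact: (proj2 (hQL k t)).
- exact: initial_weight_ge0.
Qed.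

Let E1_bounded : bounded_by (expR rho) E1.
Proof. exact: bounded_adjoint (expR_ge0 rho) E1J1 J1_bounded. Qed.
Let Ew_bounded : bounded_by (expR rho) Ew.
Proof. exact: bounded_adjoint (expR_ge0 rho) EwJw Jw_bounded. Qed.

Let N_bounded : exists2 cN, 0 <= cN & bounded_by cN N.
Proof.
have e0 := expR_ge0 rho.
have s1 := bounded_comp e0 (bounded_comp (sqr_ge0 cQ) E1_bounded (op_bounded mQ)) J1_bounded.
have s2 := bounded_comp e0 (bounded_comp (sqr_ge0 cL) Ew_bounded (op_bounded mL)) Jw_bounded.
have pos (e q l i : R) : 0 <= e ->
    0 <= 2 * (2 * (e * (q ^+ 2 * e)) + 2 * (e * (l ^+ 2 * e))) + 2 * i ^+ 2.
  move=> e_ge0; have := mulr_ge0 (mulr_ge0 e_ge0 (sqr_ge0 q)) e_ge0.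
  have := mulr_ge0 (mulr_ge0 e_ge0 (sqr_ge0 l)) e_ge0; have := sqr_ge0 i; lra.
eexists; last exact: bounded_add (bounded_add s1 s2) (op_bounded mM).
exact: pos e0.
Qed.

Let W_ge v : delta * ip v v <= ip (op mR v) v.
Proof.
rewrite -subr_ge0 -(siZl (ip_semi (H m))) -(siBl (ip_semi (H m))).
apply: ip_pointwise_ge0 => k t; have := hR k t (proc v k t).
by rewrite mulmxBl mul_scalar_mx.
Qed.

Let WW : adjoint (op mR) (op mR).
Proof. by apply: op_selfadjoint; case: hD => _ [_ _ _ [_ sR]]. Qed.

Let system := optimality_system K K' (op mC) (op_tr mC) N (op mR).

Let al : H n := in_L2rho noise_measurable (let: conj (And4 _ _ _ hal) _ := hD in hal).

Let state_eqP (v : H m) (y : H n) :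
  state_eq P w D (proc v) (proc y) <-> y - K y ≈ op mC v + al.
Proof.
have pK k t : proc (K y) k t = matA D k t *m yprime P w (proc y) k t +
    matB D k t *m zprime P w (proc y) k t by rewrite -E1E -EwE.
split=> [h|/eqv_ae_same h k].
  apply/eqv_ae_same => k; apply: filterS (h k) => t ht _.
  rewrite -[LHS]/(proc y k t - proc (K y) k t) pK ht.
  rewrite -[RHS]/(matC D k t *m proc v k t + inhom D k t).
  by rewrite -[X in X - _]addrA addrAC subrr add0r.
have := h k; apply: filterS => t /(_ I).
rewrite -[LHS]/(proc y k t - proc (K y) k t) pK.
by rewrite -[RHS]/(matC D k t *m proc v k t + inhom D k t) => /eqP; rewrite subr_eq addrC addrA => /eqP.
Qed.

(** Both shifts vanish at time 0, which leaves the initial condition there. *)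
Let costate_eqP (x y : H n) :
  ((forall k, {ae P, forall t,
      proc x k.+1 t = expR rho *: ((matA D k t)^T *m proc x k t)
        - expR rho *: (wtQ D k t *m yprime P w (proc y) k t)
        + w k t *: (expR rho *: ((matB D k t)^T *m proc x k t
                                 - wtL D k t *m zprime P w (proc y) k t))}) /\
   {ae P, forall t, proc x 0%N t = - (wtM D *m proc y 0%N t)})
  <-> x - K' x ≈ - N y.
Proof.
have x0 t : proc (x - K' x) 0%N t = proc x 0%N t.
  by rewrite -[LHS]/(proc x 0%N t - (0 + 0)) addr0 subr0.
have n0 t : proc (- N y) 0%N t = - (wtM D *m proc y 0%N t).
  by rewrite -[LHS]/(- (0 + 0 + wtM D *m proc y 0%N t)) !add0r.
have xS k t : proc (x - K' x) k.+1 t = proc x k.+1 t -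
    (expR rho *: ((matA D k t)^T *m proc x k t) +
     w k t *: (expR rho *: ((matB D k t)^T *m proc x k t))).
  rewrite -[LHS]/(proc x k.+1 t - ((expR rho * 1) *: ((matA D k t)^T *m proc x k t) +
    (expR rho * w k t) *: ((matB D k t)^T *m proc x k t))).
  by rewrite mulr1 scalerA (mulrC (w k t)).
have nS k t : proc (- N y) k.+1 t =
    - (expR rho *: (wtQ D k t *m yprime P w (proc y) k t) +
     w k t *: (expR rho *: (wtL D k t *m zprime P w (proc y) k t))).
  rewrite -E1E -EwE.
  rewrite -[LHS]/(- ((expR rho * 1) *: (wtQ D k t *m proc (E1 y) k t) +
    (expR rho * w k t) *: (wtL D k t *m proc (Ew y) k t) + 0 *m proc y k.+1 t)).
  by rewrite mul0mx addr0 mulr1 scalerA (mulrC (w k t)).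
have shuffle (u p q r s : 'cV[R]_n) (c1 : R) :
    (u = p - q + c1 *: (expR rho *: (r - s))) <->
    (u - (p + c1 *: (expR rho *: r)) = - (q + c1 *: (expR rho *: s))).
  rewrite !scalerBr; split=> [->|/eqP].
    by rewrite addrACA -opprD [X in X - _]addrC addrK.
  by rewrite subr_eq opprD addrC addrACA => /eqP.
split=> [[h h0]|/eqv_ae_same h].
  apply/eqv_ae_same => -[|k].
    by apply: filterS h0 => t e _; rewrite x0 n0.
  by apply: filterS (h k) => t /shuffle e _; rewrite xS nS.
split=> [k|].
  by have := h k.+1; apply: filterS => t /(_ I); rewrite xS nS => /shuffle.
by have := h 0%N; apply: filterS => t /(_ I); rewrite x0 n0.
Qed.

Let gain_eqP (x : H n) (v : H m) :
  (forall k, {ae P, forall t,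
     0 = (matC D k t)^T *m proc x k t - wtR D k t *m proc v k t})
  <-> op mR v ≈ op_tr mC x.
Proof.
split=> [h|/eqv_ae_same h k].
  apply/eqv_ae_same => k; apply: filterS (h k) => t /esym/eqP e _.
  by move: e; rewrite subr_eq0 => /eqP e; rewrite -[LHS]/(wtR D k t *m proc v k t) -e.
have := h k; apply: filterS => t /(_ I) e.
by rewrite -[wtR D k t *m _]/(proc (op mR v) k t) e; exact: (esym (subrr _)).
Qed.


Let mRi := invmx_multiplier P delta0 hR (let: conj _ (And4 _ _ _ hR') := hD in proj1 (proj1 hR')).

Let gain_bound_ge0 : 0 <= delta ^- 2. Proof. by rewrite invr_ge0 sqr_ge0. Qed.

Let fb (x : H n) : H m := mul_op gain_bound_ge0 mRi (op_tr mC x).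

Let fbE (x : H n) : proc (fb x) = feedback D (proc x).
Proof. by apply/funext => k; apply/funext => t; rewrite /feedback -mulmxA. Qed.

Let unitR k t : wtR D k t \in unitmx.
Proof. exact: nonneg_def_unit delta0 (hR k t). Qed.

(** Only [W v ≈ C' x] is known of the control found in the abstract problem;
    since the weight is coercive, this determines it up to [≈]. *)
Let fb_system x y v : system al x y v -> system al x y (fb x).
Proof.
move=> [hy hx hv].
have Wfb : op mR (fb x) ≈ op_tr mC x.
  by apply/gain_eqP => k; apply: aeW => t; rewrite fbE /feedback -mulmxA mulKVmx ?unitR // subrr.
have vfb : v ≈ fb x.
  apply/eqvP; rewrite -(pmulr_rle0 _ delta0); apply: le_trans (W_ge _) _.
  by rewrite (adjointB WW) (ipE (H m)) hv Wfb subrr.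
split; [move=> z|exact: hx|exact: Wfb].
rewrite hy (siDl (ip_semi (H n))) [RHS](siDl (ip_semi (H n))).
by rewrite (adjoint_eqv (op_adjoint mC) vfb).
Qed.

(** The cost is defined by a chosen state.  All quadratic terms being
    nonnegative, its integral splits into pairings. *)
Let cost_form (v : H m) : exists e : H n, e - K e ≈ op mC v + al /\
  cost P w rho D (proc v) = (2^-1 * (ip (N e) e + ip (op mR v) v))%:E.
Proof.
pose S := [set y | L2 y /\ state_eq P w D (proc v) y].
have [y0 hy0] := resolvent_exists KK' K'_bounded (op mC v + al).
have [L2e se] : S (state P w rho D (proc v)).
  apply: (@xgetPex _ _ S); exists (proc y0); split; first exact: L2rho_proc.
  exact/state_eqP.
pose e : H n := in_L2rho noise_measurable L2e.
exists e; split; first by apply/state_eqP.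
have M0 := initial_weight_ge0.
have R0 := gain_weight_ge0.
rewrite /cost -[state P w rho D (proc v)]/(proc e) ip_NE -E1E -EwE.
pose term p (g h : H p) k t := expR (- rho * k%:R) * inner (proc g k t) (proc h k t).
have term0 p (X : process T R p p) cX (hX : multiplier P w X (cX ^+ 2)) (g : H p) :
    (forall k t, nonneg_def (X k t)) -> forall k t, 0 <= term p (op hX g) g k t.
  by move=> X0 k t; rewrite mulr_ge0 ?expR_ge0 //; exact: X0.
have iT p (X : process T R p p) cX (hX : multiplier P w X (cX ^+ 2)) (g : H p) :
    (forall k t, nonneg_def (X k t)) ->
    (\int[P]_t (\sum_(0 <= k <oo) (term p (op hX g) g k t)%:E) = (ip (op hX g) g)%:E)%E.
  move=> X0; apply: (integral_process_ip noise_measurable (L2rho_proc _) (L2rho_proc _)).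
  by move=> k t; exact: X0.
have mT p (g h : H p) : (forall k t, 0 <= term p g h k t) ->
    measurable_fun setT (fun t => \sum_(0 <= k <oo) (term p g h k t)%:E)%E.
  move=> g0; apply: ge0_emeasurable_sum => [k t _ _|k _]; first by rewrite lee_fin.
  apply/measurable_EFinP; apply: measurable_funM => //.
  apply: measurable_inner; first by case: (L2rho_square_integrable noise_measurable k (L2rho_proc g)).
  by case: (L2rho_square_integrable noise_measurable k (L2rho_proc h)).
have Q0 k t : nonneg_def (wtQ D k t) := proj1 (hQL k t).
have L0 k t : nonneg_def (wtL D k t) := proj2 (hQL k t).
have pull : (\int[P]_t ((inner (wtM D *m proc e 0%N t) (proc e 0%N t))%:E +
     \sum_(0 <= k <oo) (expR (- rho * k%:R) *
       (inner (wtQ D k t *m proc (E1 e) k t) (proc (E1 e) k t)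
        + inner (wtL D k t *m proc (Ew e) k t) (proc (Ew e) k t)
        + inner (wtR D k t *m proc v k t) (proc v k t)))%:E) =
   \int[P]_t (\sum_(0 <= k <oo) (term n (op mM e) e k t)%:E +
     (\sum_(0 <= k <oo) (term n (op mQ (E1 e)) (E1 e) k t)%:E +
     (\sum_(0 <= k <oo) (term n (op mL (Ew e)) (Ew e) k t)%:E +
     \sum_(0 <= k <oo) (term m (op mR v) v k t)%:E))))%E.
  apply: eq_integral => t _; congr (_ + _)%E.
    rewrite (@nneseriesD1 _ _ 0%N) // => [|k _]; last by rewrite lee_fin; exact: term0.
    rewrite eseries0 => [|k _ /andP[_ k0]]; last first.
      by rewrite /term /= /initial_weight (negbTE k0) mul0mx (si0l (inner_semi R n)) mulr0.
    by rewrite adde0 /term mulr0 expR0 mul1r.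
  have LR0 k : (0 <= (term n (op mL (Ew e)) (Ew e) k t)%:E + (term m (op mR v) v k t)%:E)%E.
    by rewrite adde_ge0 // lee_fin; [exact: term0 L0 _ _|exact: term0 R0 _ _].
  rewrite -nneseriesD; last 2 first.
  - by move=> k _ _; rewrite lee_fin; exact: term0.
  - by move=> k _ _; rewrite lee_fin; exact: term0.
  rewrite -nneseriesD; last 2 first.
  - by move=> k _ _; rewrite lee_fin; exact: term0.
  - by move=> k _ _; exact: LR0.
  apply: eq_eseriesr => k _; rewrite -!EFinD /term -!mulrDr.
  by rewrite addrA.
rewrite [X in (_ * X)%E]pull {pull}.
have S0 p (X : process T R p p) cX (hX : multiplier P w X (cX ^+ 2)) (g : H p) t :
    (forall k t, nonneg_def (X k t)) ->
    (0 <= \sum_(0 <= k <oo) (term p (op hX g) g k t)%:E)%E.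
  by move=> X0; apply: nneseries_ge0 => k _ _; rewrite lee_fin; exact: term0.
have mS p (X : process T R p p) cX (hX : multiplier P w X (cX ^+ 2)) (g : H p) :
    (forall k t, nonneg_def (X k t)) ->
    measurable_fun setT (fun t => \sum_(0 <= k <oo) (term p (op hX g) g k t)%:E)%E.
  by move=> X0; apply: mT => k t; exact: term0.
have [sM sQ sL sR] := And4 (S0 _ _ _ mM e ^~ M0) (S0 _ _ _ mQ (E1 e) ^~ Q0)
  (S0 _ _ _ mL (Ew e) ^~ L0) (S0 _ _ _ mR v ^~ R0).
have [tM tQ tL tR] := And4 (mS _ _ _ mM e M0) (mS _ _ _ mQ (E1 e) Q0)
  (mS _ _ _ mL (Ew e) L0) (mS _ _ _ mR v R0).
rewrite ge0_integralD //; last 2 first.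
- by move=> t _; rewrite !adde_ge0.
- by apply: emeasurable_funD => //; exact: emeasurable_funD.
rewrite ge0_integralD //; last 2 first.
- by move=> t _; rewrite adde_ge0.
- exact: emeasurable_funD.
rewrite ge0_integralD //.
rewrite (iT _ _ _ mM e M0) (iT _ _ _ mQ (E1 e) Q0) (iT _ _ _ mL (Ew e) L0) (iT _ _ _ mR v R0).
rewrite -!EFinD -EFinM; congr (_ * _)%:E.
by rewrite [in RHS](addrC (_ + _) (ip (op mM e) e)) -!addrA.
Qed.

Let cost_ge x y v (u : H m) : system al x y v ->
  ((2^-1 * (ip (N y) y + ip (op mR v) v + delta * ip (u - v) (u - v)))%:E
     <= cost P w rho D (proc u))%E.
Proof.
move=> hs; have [e [he ->]] := cost_form u.
rewrite lee_fin ler_wpM2l ?invr_ge0 //.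
exact: (optimality_system_minimal KK' (op_adjoint mC) NN N_ge0 WW W_ge hs he).
Qed.

Let cost_eq x y v : system al x y v ->
  cost P w rho D (proc v) = (2^-1 * (ip (N y) y + ip (op mR v) v))%:E.
Proof.
move=> [hy _ _]; have [e [he ->]] := cost_form v.
have ey : e ≈ y := resolvent_unique KK' K'_bounded he hy.
by rewrite (adjoint_eqv NN ey) (eqvr _ ey).
Qed.

Lemma hamiltonian_solution : exists x y : process T R n 1,
  let v := feedback D x in
  [/\ N2rho P w rho x y,
      hamiltonian_system P w rho D x y v,
      forall x' y' v', N2rho P w rho x' y' ->
        hamiltonian_system P w rho D x' y' v' ->
        ae_same P x' x /\ ae_same P y' y,
      optimal_control P w rho D v
    & forall u, optimal_control P w rho D u -> ae_same P u v].
Proof.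
have [cN cN0 hN] := N_bounded.
have [x [y [v0 s0]]] := optimality_system_exists KK' K'_bounded (op_adjoint mC)
  (sqr_ge0 c) (op_bounded mC) NN N_ge0 cN0 hN WW (sqr_ge0 cR) (op_bounded mR)
  delta0 W_ge al.
have s := fb_system s0; have [hy hx hv] := s.
have inf_cost : cost P w rho D (proc (fb x)) =
    ereal_inf (cost P w rho D @` admissible_control P w rho).
  apply/eqP; rewrite eq_le; apply/andP; split; last first.
    apply: ereal_inf_lbound; exists (proc (fb x)) => //; exact: L2rho_proc.
  apply: le_ereal_inf_tmp => _ [u hu <-].
  have := cost_ge (in_L2rho noise_measurable hu) s; apply: le_trans.
  rewrite (cost_eq s) lee_fin ler_wpM2l ?invr_ge0 // lerDl mulr_ge0 ?ip_ge0 //.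
  exact: ltW.
exists (proc x), (proc y); rewrite /= -fbE; split.
- by split; exact: L2rho_proc.
- have [hx1 hx0] := (costate_eqP x y).2 hx.
  by split; [exact: hx1|exact/state_eqP|exact: hx0|exact/gain_eqP].
- move=> x' y' v' [Lx' Ly'] [hx1 hy' hx0 hv'].
  pose X : H n := in_L2rho noise_measurable Lx'.
  pose Y : H n := in_L2rho noise_measurable Ly'.
  have v'E k : {ae P, forall t, v' k t = proc (fb X) k t}.
    apply: filterS (hv' k) => t /esym/eqP; rewrite subr_eq0 => /eqP e.
    by rewrite fbE /feedback -mulmxA e mulKmx ?unitR.
  have sX : system al X Y (fb X).
    split.
    + apply/state_eqP => k; apply: filterS2 (hy' k) (v'E k) => t e ve.
      by rewrite -ve.
    + by apply/costate_eqP.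
    + apply/gain_eqP => k; apply: filterS2 (hv' k) (v'E k) => t e ve.
      by rewrite -ve.
  have [xx yy _] := optimality_system_unique KK' K'_bounded (op_adjoint mC) NN N_ge0 WW
    delta0 W_ge sX s.
  by split; [exact: ((eqv_ae_same X x).1 xx)|exact: ((eqv_ae_same Y y).1 yy)].
- by split=> //; exact: L2rho_proc.
- move=> u [hu cu]; pose U : H m := in_L2rho noise_measurable hu.
  suff e : U ≈ fb x by exact: ((eqv_ae_same U (fb x)).1 e).
  have := cost_ge U s; rewrite [cost _ _ _ _ _]cu -inf_cost (cost_eq s) lee_fin.
  have null (r q e : R) : 0 < e -> 2^-1 * (r + e * q) <= 2^-1 * r -> q <= 0.
    by move=> e0 h; rewrite -(pmulr_rle0 _ e0); lra.
  by move=> /(null _ _ _ delta0) h; apply/eqvP.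
Qed.

End Operators.

End BackwardLQ.

Theorem theorem4p2 (d : measure_display) (T : measurableType d) (R : realType)
    (n m : nat) (P : probability T R) (w : nat -> T -> R) (rho : R)
    (D : blq_data T R n m)
    (hP : measure_is_complete P)
    (hw : mart_diff_noise P w)
    (hD : blq_admissible P w rho D)
    (hM : pos_def (wtM D))
    (hQL : forall k t, nonneg_def (wtQ D k t) /\ nonneg_def (wtL D k t))
    (hR : exists2 delta : R, 0 < delta &
            forall k t, nonneg_def (wtR D k t - delta%:M))
    (hrho : (rho%:E < - lne (6%:E *
               (sup_norm P (matA D) + sup_norm P (matB D)) ^+ 2))%E) :
  exists x y : process T R n 1,
    let v := feedback D x in
    [/\ N2rho P w rho x y,
        hamiltonian_system P w rho D x y v,
        forall x' y' v', N2rho P w rho x' y' ->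
          hamiltonian_system P w rho D x' y' v' ->
          ae_same P x' x /\ ae_same P y' y,
        optimal_control P w rho D v
      & forall u, optimal_control P w rho D u -> ae_same P u v].
Proof.
have [delta delta0 hRd] := hR.
have [E1 [Ew [a1 aw e1 ew]]] := mean_operators n rho hw.
exact: (hamiltonian_solution hD hM hQL delta0 hRd hrho a1 aw e1 ew).
Qed.
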